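(* Let $K,H$ be Hilbert spaces (both real or both complex) with $\dim K<\infty$, and let $\mathcal{B}$ be the open unit ball of $L(K,H)$, with the metric $\rho$. If a group $G$ of $\rho$-isometric maps of $\mathcal{B}$ has at least one orbit separated from the boundary, then it has a fixed point, i.e. there is a point of $\mathcal{B}$ fixed by all elements of $G$.
   Context: $L(K,H)$ is the Banach space of all bounded linear operators from $K$ to $H$ with the operator norm. For $A\in\mathcal{B}$ the Möbius transformation $M_A:\mathcal{B}\to\mathcal{B}$ is $$M_A(X)=(1-AA^* )^{-1/2}(A+X)(1+A^*X)^{-1}(1-A^*A)^{1/2};$$ it satisfies $M_A^{-1}=M_{-A}$. The metric $\rho$ on $\mathcal{B}$ is defined by $\rho(A,B)=\tanh^{-1}(\|M_{-A}(B)\|)$ (in the complex case it is the Carathéodory distance of $\mathcal{B}$). A group of $\rho$-isometric maps is a group under composition of bijections of $\mathcal{B}$ preserving $\rho$. The orbit of $X\in\mathcal{B}$ is $G(X)=\{g(X):g\in G\}$. A subset of $\mathcal{B}$ is separated from the boundary if there is $r<1$ such that all its elements have norm at most $r$ (equivalently, it is $\rho$-bounded). *)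

(* Defs.v *)
From HB Require Import structures.
From mathcomp Require Import all_boot all_order all_algebra.
From mathcomp Require Import sesquilinear.
From mathcomp Require Import all_classical all_reals all_analysis.
From mathcomp Require Import complex ring.

Set Implicit Arguments.
Unset Strict Implicit.
Unset Printing Implicit Defensive.

Import Order.TTheory GRing.Theory Num.Theory.
Import numFieldNormedType.Exports.

Local Open Scope classical_set_scope.
Local Open Scope ring_scope.

Variant scalar_kind := RealScalars | ComplexScalars.

Definition scalars (R : realType) (s : scalar_kind) : numFieldType :=
  match s with RealScalars => R | ComplexScalars => R[i] end.

Definition scalar_conj (R : realType) (s : scalar_kind) :
    scalars R s -> scalars R s :=
  match s with RealScalars => idfun | ComplexScalars => @conjc R end.

Definition scalar_Re (R : realType) (s : scalar_kind) : scalars R s -> R :=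
  match s with RealScalars => idfun | ComplexScalars => @complex.Re R end.

Section BoundedOperators.
Variables (F : numFieldType) (V W : normedModType F).

Definition bounded_linear : {pred V -> W} :=
  mem [set f : V -> W | linear f /\ exists M, forall x, `|f x| <= M * `|x|].

Record boundedOp := BoundedOp {
  boundedOp_fun :> V -> W;
  boundedOp_subproof : boundedOp_fun \in bounded_linear }.

HB.instance Definition _ := [isSub for boundedOp_fun].
HB.instance Definition _ := [Choice of boundedOp by <:].

Lemma bounded_linear_submod_closed : submod_closed bounded_linear.
Proof.
split=> [|a f g].
  rewrite inE; split=> [b x y|]; first by rewrite scaler0 addr0.
  by exists 0 => x; rewrite normr0 mul0r.
rewrite !inE => -[lf [M fM]] [lg [N gN]]; split=> [b x y|].
  rewrite !fctE lf lg !scalerDr !scalerA (mulrC a b).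
  by rewrite addrACA.
exists (`|a| * M + N) => x; rewrite !fctE (le_trans (ler_normD _ _))//.
by rewrite mulrDl lerD// normrZ -mulrA ler_wpM2l.
Qed.

HB.instance Definition _ :=
  GRing.isSubmodClosed.Build F (V -> W) bounded_linear
    bounded_linear_submod_closed.
HB.instance Definition _ := [SubChoice_isSubLmodule of boundedOp by <:].

End BoundedOperators.

Section OperatorAlgebra.
Variables (F : numFieldType).

Lemma idfun_bounded_linear (V : normedModType F) :
  idfun \in @bounded_linear F V V.
Proof. by rewrite inE; split=> //; exists 1 => x; rewrite mul1r. Qed.

Definition idop (V : normedModType F) : boundedOp V V :=
  BoundedOp (idfun_bounded_linear V).

Lemma comp_bounded_linear (U V W : normedModType F) (A : boundedOp V W)
  (B : boundedOp U V) : A \o B \in @bounded_linear F U W.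
Proof.
case: A B => [f /= +] [g /= +]; rewrite !inE => -[lf [M fM]] [lg [N gN]].
split=> [a x y|]; first by rewrite /= lg lf.
exists (`|M| * N) => x; have [/eqP|x0] := eqVneq (g x) 0.
  move=> /eqP gx0; have := fM 0; rewrite normr0 mulr0 /= gx0 => /le_trans; apply.
  have [->|nx0] := eqVneq x 0; first by rewrite normr0 mulr0.
  have := gN x; rewrite gx0 normr0 -mulrA => ?; exact: mulr_ge0.
apply: le_trans (fM _) _; rewrite -mulrA.
have M0 : 0 <= M by rewrite -(pmulr_lge0 _ (_ : 0 < `|g x|)) ?normr_gt0 //;
  apply: le_trans (fM _).
by rewrite ger0_norm// ler_wpM2l.
Qed.

Definition compop (U V W : normedModType F) (A : boundedOp V W)
  (B : boundedOp U V) : boundedOp U W := BoundedOp (comp_bounded_linear A B).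

(* In [invop], [adjoint] and [sqrtop], [xget] picks the unique operator with the
   stated property, and returns 0 if there is none. *)
Definition invop (V : normedModType F) (T : boundedOp V V) : boundedOp V V :=
  xget 0 [set S : boundedOp V V | compop S T = idop V /\ compop T S = idop V].

End OperatorAlgebra.

Notation "A \c B" := (compop A B)
  (at level 40, left associativity) : ring_scope.

Definition tanh (R : realType) (x : R) : R :=
  (expR x - expR (- x)) / (expR x + expR (- x)).

Definition artanh (R : realType) (t : R) : R := ln ((1 + t) / (1 - t)) / 2.

Lemma artanhK (R : realType) (t : R) : -1 < t < 1 -> tanh (artanh t) = t.
Proof.
move=> /andP[t1 t2]; rewrite /tanh /artanh expRN.
have d0 : 0 < 1 - t by rewrite subr_gt0.
have n0 : 0 < 1 + t by rewrite -ltrBlDl sub0r.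
set u := (1 + t) / (1 - t); have u0 : 0 < u by rewrite divr_gt0.
set w := expR _; have w0 : 0 < w by exact: expR_gt0.
have w2 : w ^+ 2 = u.
  by rewrite /w -expRM_natl mulrC divfK ?pnatr_eq0// lnK.
have -> : (w - w^-1) / (w + w^-1) = (w ^+ 2 - 1) / (w ^+ 2 + 1).
  by field; rewrite !gt_eqF ?addr_gt0 ?exprn_gt0.
by rewrite w2 /u; field; rewrite (gt_eqF d0) (gt_eqF (addr_gt0 n0 d0)).
Qed.

HB.mixin Record CompleteNormedModule_isHilbert (R : realType)
    (s : scalar_kind) V of CompleteNormedModule (scalars R s) V := {
  inner : {dot V for @scalar_conj R s};
  inner_normE : forall x : V, inner x x = `|x| ^+ 2 }.

#[short(type="hilbertType")]
HB.structure Definition Hilbert (R : realType) (s : scalar_kind) :=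
  {V of CompleteNormedModule (scalars R s) V
      & CompleteNormedModule_isHilbert R s V}.

Section HilbertOperators.
Variables (R : realType) (s : scalar_kind).
Implicit Types K H : hilbertType R s.

Definition finite_dimensional K :=
  exists (n : nat) (e : 'I_n -> K), forall x : K,
    exists c : 'I_n -> scalars R s, x = \sum_(i < n) c i *: e i.

(* Norms of vectors take values in [scalars R s] (as real elements). The
   operator norm is taken in R. *)
Definition opnorm K H (A : boundedOp K H) : R :=
  sup [set scalar_Re `|A x| | x in [set x : K | `|x| <= 1]].

Definition adjoint K H (A : boundedOp K H) : boundedOp H K :=
  xget 0 [set B : boundedOp H K | forall x y, inner (A x) y = inner x (B y)].

(* Self-adjointness is not implied by the second condition when the scalars
   are real. *)
Definition positive_op H (T : boundedOp H H) :=
  (forall x y, inner (T x) y = inner x (T y)) /\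
  (forall x, 0 <= inner (T x) x).

Definition sqrtop H (T : boundedOp H H) : boundedOp H H :=
  xget 0 [set S : boundedOp H H | positive_op S /\ S \c S = T].

Definition mobius K H (A X : boundedOp K H) : boundedOp K H :=
  invop (sqrtop (idop H - A \c adjoint A))
    \c (A + X)
    \c invop (idop K + adjoint A \c X)
    \c sqrtop (idop K - adjoint A \c A).

Record opBall K H := OpBall {
  opBall_op :> boundedOp K H;
  opBall_subproof : opnorm opBall_op < 1 }.

Definition rho K H (A B : opBall K H) : R :=
  artanh (opnorm (mobius (- (A : boundedOp K H)) B)).

Definition rho_isometry_group K H (G : set (opBall K H -> opBall K H)) :=
  [/\ G idfun,
      forall g h, G g -> G h -> G (g \o h),
      forall g, G g -> exists h, [/\ G h, cancel g h & cancel h g]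
    & forall g, G g -> forall A B, rho (g A) (g B) = rho A B].

Definition map_orbit K H (G : set (opBall K H -> opBall K H)) (X : opBall K H) :
  set (opBall K H) := [set g X | g in G].

Definition separated_from_boundary K H (E : set (opBall K H)) :=
  exists r : R, r < 1 /\ forall X, E X -> opnorm X <= r.

End HilbertOperators.

(* Main.v *)
Require Import Defs.
From mathcomp Require Import all_boot all_order all_algebra.
From mathcomp Require Import sesquilinear.
From mathcomp Require Import all_classical all_reals all_analysis.
From mathcomp Require Import complex ring lra.

(** Write A' for the adjoint of A.  The proof replaces the metric by the
    condition sinh2_le mu X B:

      |X v - B u|^2 + mu |X v|^2 <= |v - u|^2 + mu |v|^2   for all v, u in K,

    which holds exactly when sinh(rho(B, X))^2 <= mu (mobius_le).  To see this,
    observe that the Moebius map M sending B to 0 acts on the graph of X as a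
    hyperbolic rotation of K + H, so it preserves the indefinite form
    |v|^2 - |X v|^2.  Comparing this form with the norm of the first component
    of the rotated vector, which is a supremum over u, turns the bound
    |M(X)| <= t into the displayed family of inequalities.

    The left-hand side is a convex quadratic function of X.  Closed rho-balls
    are therefore closed convex sets of operators for the ordinary vector space
    structure, and linear midpoints serve as metric midpoints.  The group
    elements need not respect convexity, but they map rho-balls to rho-balls,
    and a fixed point is found by the normal structure argument.

    - The operators that lie within a fixed large distance of every point of the
      given orbit form a set that is nonempty, G-invariant, convex, closed and
      separated from the boundary (sinh2_le_ball, sinh2_le_inside).
    - A chain of nonempty closed convex subsets of it has a common point
      (nested_inter), because K has finite dimension and the Hilbert-Schmidt
      norm is then an equivalent norm satisfying the parallelogram law.  Zorn's
      lemma provides a minimal closed convex G-invariant set C.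
    - If C had more than one point, let mu be the least number such that
      sinh2_le mu X B for all X, B in C.  Some X in C satisfies sinh2_le nu X B
      for all B in C with a smaller nu (normal_structure).  The set of all such
      X is again closed, convex and G-invariant, so it is all of C, against the
      choice of mu.  Hence C is a single point, which G fixes.

    For normal_structure, let gap be the difference of the two sides of the
    inequality.  Passing to the midpoint of X and Y increases the gap at v by
    (1 + mu)/4 |X v - Y v|^2, a gain at each v where some two elements of C
    differ.  At a unit vector v where all elements of C nearly agree the gap is
    bounded below anyway, by the inequality |B(v - u)| <= a |v - u| with a < 1.
    The unit ball of K has finite nets, so finitely many midpoints make the gap
    uniformly positive. *)

Set Implicit Arguments.
Unset Strict Implicit.
Unset Printing Implicit Defensive.

Import Order.TTheory GRing.Theory Num.Theory.
Import numFieldNormedType.Exports.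

Local Open Scope classical_set_scope.
Local Open Scope ring_scope.


(** * Real and complex scalars treated uniformly *)

Section Scalars.
Variables (R : realType) (s : scalar_kind).
Local Notation F := (scalars R s).

(** Norms are scalars that happen to be real; [scal] and [scalar_Re] translate
    between them and genuine real numbers. *)
Definition scal (r : R) : F :=
  match s return scalars R s with
  | RealScalars => r | ComplexScalars => real_complex R r end.

Lemma scal_Re r : scalar_Re (scal r) = r. Proof. by rewrite /scal; case: s. Qed.
Lemma scalar_ReD (a b : F) : scalar_Re (a + b) = scalar_Re a + scalar_Re b.
Proof. by move: a b; case: s => //= -[? ?] []. Qed.
Lemma scalar_ReN (a : F) : scalar_Re (- a) = - scalar_Re a.
Proof. by move: a; case: s => //= -[]. Qed.
Lemma scalar_Re_scal r (a : F) : scalar_Re (scal r * a) = r * scalar_Re a.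
Proof. by rewrite /scal; move: a; case: s => //= -[] ? ? /=; rewrite mul0r subr0. Qed.
Lemma scalar_Re_conj (a : F) : scalar_Re (scalar_conj a) = scalar_Re a.
Proof. by move: a; case: s => //= -[]. Qed.
Lemma scal_conj r : scalar_conj (scal r) = scal r.
Proof. by rewrite /scal; case: s => //=; rewrite oppr0. Qed.
Lemma mul_scalar_conj (a : F) : scalar_conj a * a = `|a| ^+ 2.
Proof.
move: a; case: s => //= a; first by rewrite real_normK ?num_real.
by rewrite (mulrC (conjc a)) -normCK.
Qed.
Lemma scal_ge0 r : (0 <= scal r) = (0 <= r).
Proof. by rewrite /scal; case: s => //=; rewrite lecR. Qed.
Lemma ge0_scal (a : F) : 0 <= a -> a = scal (scalar_Re a).
Proof.
rewrite /scal; move: a; case: s => //= -[x y].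
by rewrite lecE /= => /andP[/eqP -> _].
Qed.
Lemma scalB a b : scal (a - b) = scal a - scal b.
Proof. by rewrite /scal; case: s => //; rewrite rmorphB. Qed.
Lemma scalD a b : scal (a + b) = scal a + scal b.
Proof. by rewrite /scal; case: s => //; rewrite rmorphD. Qed.
Lemma scalM a b : scal (a * b) = scal a * scal b.
Proof. by rewrite /scal; case: s => //; rewrite rmorphM. Qed.
Lemma scal1 : scal 1 = 1. Proof. by rewrite /scal; case: s. Qed.
Lemma scal0 : scal 0 = 0. Proof. by rewrite /scal; case: s. Qed.
Lemma scal_nat n : scal n%:R = n%:R.
Proof. by elim: n => [|n IH]; rewrite ?scal0// -!natr1 scalD IH scal1. Qed.
Lemma ler_scal a b : (scal a <= scal b) = (a <= b).
Proof. by rewrite -subr_ge0 -scalB scal_ge0 subr_ge0. Qed.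
Lemma scal_inj : injective scal.
Proof. by move=> a b /(congr1 (@scalar_Re R s)); rewrite !scal_Re. Qed.
Lemma ltr_scal a b : (scal a < scal b) = (a < b).
Proof. by rewrite !lt_neqAle ler_scal (inj_eq scal_inj). Qed.
Lemma scalar_Re_le (a b : F) : a <= b -> scalar_Re a <= scalar_Re b.
Proof.
rewrite -subr_ge0 => ab; rewrite -subr_ge0 -scalar_ReN -scalar_ReD.
by rewrite -scal_ge0 -ge0_scal.
Qed.
Lemma scal_norm (r : R) : `|scal r| = scal `|r|.
Proof.
have pos x : 0 <= x -> `|scal x| = scal x by move=> x0; apply: ger0_norm; rewrite scal_ge0.
have [r0|r0] := leP 0 r; first by rewrite pos // (ger0_norm r0).
have -> : scal r = - scal (- r) by rewrite -[- r]sub0r scalB scal0 sub0r opprK.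
by rewrite normrN pos ?oppr_ge0 ?(ltr0_norm r0)// ltW.
Qed.

(** Total boundedness of a disc of scalars, by a square grid;
    [unit_ball_net] transports this compactness to K. *)
Lemma scalar_net (M d : R) : 0 < d -> exists L : seq F,
  forall z : F, scalar_Re `|z| <= M -> exists2 l, l \in L & scalar_Re `|z - l| <= d.
Proof.
have real_net e : 0 < e -> exists L : seq R,
    forall x : R, `|x| <= M -> exists2 l, l \in L & `|x - l| <= e.
  move=> e0; exists [seq k%:R * e - M | k <- iota 0 (Num.truncn ((M + M) / e)).+1].
  move=> x; rewrite ler_norml => /andP[x1 x2].
  have xM : 0 <= (x + M) / e by apply: divr_ge0; [rewrite -lerBlDr sub0r | exact: ltW].
  set k := Num.truncn ((x + M) / e).
  have /andP[k1 k2] : k%:R <= (x + M) / e < k.+1%:R by exact: truncn_itv.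
  exists (k%:R * e - M).
    apply/mapP; exists k => //; rewrite mem_iota/= add0n ltnS.
    by apply: le_truncn; rewrite ler_pM2r ?invr_gt0// lerD2r.
  move: k1 k2; rewrite ler_pdivlMr// ltr_pdivrMr// -natr1 mulrDl mul1r => k1 k2.
  by rewrite ler_norml; lra.
case: s => /= [|d0]; first exact: real_net.
have d2 : 0 < d / 2 by rewrite divr_gt0.
have [L HL] := real_net _ d2.
exists [seq Complex a b | a <- L, b <- L] => -[a b] /= nab.
have [na nb] : `|a| <= M /\ `|b| <= M.
  by split; apply: le_trans nab; rewrite -sqrtr_sqr ler_wsqrtr// ?lerDl ?lerDr sqr_ge0.
have [a' a'L ha] := HL a na; have [b' b'L hb] := HL b nb.
exists (Complex a' b'); first by apply/allpairsP; exists (a', b').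
have sq x : `|x| <= d / 2 -> x ^+ 2 <= (d / 2) ^+ 2.
  by rewrite -[x ^+ 2]real_normK ?num_real// => ?; rewrite lerXn2r ?nnegrE// ltW.
have {}ha := sq _ ha; have {}hb := sq _ hb.
rewrite -[leRHS]gtr0_norm// -sqrtr_sqr ler_wsqrtr//; nra.
Qed.

End Scalars.

(** * The underlying real inner product *)

Section RealStructure.
Variables (R : realType) (s : scalar_kind) (V : hilbertType R s).
Implicit Types (x y z : V) (r : R) (a : scalars R s).

Definition nrm x : R := scalar_Re `|x|.
Definition rin x y : R := scalar_Re (inner x y).

Lemma normE x : `|x| = scal s (nrm x).
Proof. exact: ge0_scal. Qed.

Lemma nrm_ge0 x : 0 <= nrm x.
Proof. by rewrite -(@scal_ge0 R s) -normE. Qed.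

Lemma nrm0_eq0 x : nrm x = 0 -> x = 0.
Proof. by move=> x0; apply/normr0_eq0; rewrite normE x0 scal0. Qed.

Lemma nrm0 : nrm 0 = 0.
Proof. by rewrite /nrm normr0 -(scal0 R s) scal_Re. Qed.

Lemma nrmN x : nrm (- x) = nrm x.
Proof. by rewrite /nrm normrN. Qed.

Lemma nrm_distC x y : nrm (x - y) = nrm (y - x).
Proof. by rewrite -nrmN opprB. Qed.

Lemma nrmD x y : nrm (x + y) <= nrm x + nrm y.
Proof. by rewrite -(@ler_scal R s) scalD -!normE ler_normD. Qed.

Lemma nrmZ a x : nrm (a *: x) = scalar_Re `|a| * nrm x.
Proof. by rewrite /nrm normrZ (ge0_scal (normr_ge0 a)) scalar_Re_scal scal_Re. Qed.

Lemma nrmZr r x : nrm (scal s r *: x) = `|r| * nrm x.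
Proof. by rewrite nrmZ scal_norm scal_Re. Qed.

Lemma rinC x y : rin x y = rin y x.
Proof. rewrite /rin (@hermitian_subproof _ _ _ _ (@inner R s V)) expr0 mul1r.
exact: scalar_Re_conj. Qed.

Lemma rinDl x y z : rin (x + y) z = rin x z + rin y z.
Proof. by rewrite /rin linearDl scalar_ReD. Qed.
Lemma rinDr x y z : rin z (x + y) = rin z x + rin z y.
Proof. by rewrite !(rinC z) rinDl. Qed.
Lemma rinNl x z : rin (- x) z = - rin x z.
Proof. by rewrite /rin linearNl scalar_ReN. Qed.
Lemma rinNr x z : rin z (- x) = - rin z x.
Proof. by rewrite !(rinC z) rinNl. Qed.
Lemma rinBl x y z : rin (x - y) z = rin x z - rin y z.
Proof. by rewrite rinDl rinNl. Qed.
Lemma rinBr x y z : rin z (x - y) = rin z x - rin z y.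
Proof. by rewrite rinDr rinNr. Qed.
Lemma rinZl r x z : rin (scal s r *: x) z = r * rin x z.
Proof. by rewrite /rin linearZl_LR scalar_Re_scal. Qed.
Lemma rinZr r x z : rin z (scal s r *: x) = r * rin z x.
Proof. by rewrite !(rinC z) rinZl. Qed.
Lemma rin0l z : rin 0 z = 0.
Proof. by rewrite -(subrr 0) rinBl subrr. Qed.

Lemma rin_nrm x : rin x x = nrm x ^+ 2.
Proof. by rewrite /rin inner_normE normE expr2 -scalM scal_Re expr2. Qed.

Lemma nrmD_sq x y : nrm (x + y) ^+ 2 = nrm x ^+ 2 + 2 * rin x y + nrm y ^+ 2.
Proof. by rewrite -!rin_nrm rinDl !rinDr (rinC y); lra. Qed.
Lemma nrmB_sq x y : nrm (x - y) ^+ 2 = nrm x ^+ 2 - 2 * rin x y + nrm y ^+ 2.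
Proof. by rewrite nrmD_sq rinNr nrmN; lra. Qed.

Lemma rin_le x y : rin x y <= nrm x * nrm y.
Proof.
have [/nrm0_eq0->|nx] := eqVneq (nrm x) 0; first by rewrite rin0l nrm0 mul0r.
have [/nrm0_eq0->|ny] := eqVneq (nrm y) 0; first by rewrite rinC rin0l nrm0 mulr0.
have := sqr_ge0 (nrm (scal s (nrm y) *: x - scal s (nrm x) *: y)).
rewrite nrmB_sq rinZl rinZr !nrmZr !ger0_norm ?nrm_ge0// => h.
have p : 0 < nrm x * nrm y by rewrite mulr_gt0 // lt0r ?nx ?ny nrm_ge0.
by rewrite -(ler_pM2l p); nra.
Qed.

(** The modulus version of the Cauchy-Schwarz inequality is the real version
    applied to y rotated by the phase of the inner product. *)
Lemma norm_inner_le x y : scalar_Re `|inner x y| <= nrm x * nrm y.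
Proof.
set a := inner x y; set n := scalar_Re `|a|.
have n0 : 0 <= n by rewrite -(@scal_ge0 R s) -ge0_scal.
have [->|nn0] := eqVneq n 0; first by rewrite mulr_ge0 ?nrm_ge0.
have := rin_le x (a *: y); rewrite nrmZ.
have -> : rin x (a *: y) = n ^+ 2.
  rewrite /rin linearZr/= mul_scalar_conj (ge0_scal (normr_ge0 a)).
  by rewrite expr2 -scalM scal_Re.
by rewrite mulrCA expr2 ler_pM2l // lt0r nn0.
Qed.

End RealStructure.

(** * Bounded operators and completeness *)

Section Operators.
Variables (R : realType) (s : scalar_kind).
Implicit Types V W : hilbertType R s.

Lemma op_linear V W (A : boundedOp V W) : linear A.
Proof. by case: A => f /=; rewrite inE => -[]. Qed.

Lemma op_bound V W (A : boundedOp V W) :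
  exists2 M, 0 <= M & forall x, nrm (A x) <= M * nrm x.
Proof.
case: A => f /=; rewrite inE => -[_ [M fM]].
exists `|scalar_Re M| => // x; have := scalar_Re_le (fM x).
rewrite mulrC normE [in X in _ <= X](normE x) mulrC (mulrC M) scalar_Re_scal scal_Re mulrC => h.
by apply: le_trans h _; rewrite ler_wpM2r ?nrm_ge0 ?ler_norm.
Qed.

Lemma op_of_linear V W (f : V -> W) M : linear f ->
  (forall x, nrm (f x) <= M * nrm x) -> exists A : boundedOp V W, A =1 f.
Proof.
move=> lf fM; suff fP : f \in @bounded_linear _ V W by exists (BoundedOp fP).
rewrite inE; split=> //; exists (scal s M) => x.
by rewrite !normE -scalM ler_scal.
Qed.

Lemma addopE V W (A B : boundedOp V W) x : (A + B) x = A x + B x.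
Proof. by []. Qed.
Lemma oppopE V W (A : boundedOp V W) x : (- A) x = - A x.
Proof. by []. Qed.
Lemma scaleopE V W a (A : boundedOp V W) x : (a *: A) x = a *: A x.
Proof. by []. Qed.
Lemma compopE V W U (A : boundedOp V W) (B : boundedOp U V) x : (A \c B) x = A (B x).
Proof. by []. Qed.

Lemma op_ext V W (A B : boundedOp V W) : A =1 B -> A = B.
Proof. by move=> AB; apply/val_inj/funext. Qed.

Section Linearity.
Variables (V W : hilbertType R s) (A : boundedOp V W).
Lemma opD x y : A (x + y) = A x + A y.
Proof. by have := op_linear A 1 x y; rewrite !scale1r. Qed.
Lemma op0 : A 0 = 0.
Proof. by apply: (addrI (A 0)); rewrite -opD !addr0. Qed.
Lemma opZ a x : A (a *: x) = a *: A x.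
Proof. by have := op_linear A a x 0; rewrite op0 !addr0. Qed.
Lemma opN x : A (- x) = - A x.
Proof. by rewrite -scaleN1r opZ scaleN1r. Qed.
Lemma opB x y : A (x - y) = A x - A y.
Proof. by rewrite opD opN. Qed.
Lemma op_sum (I : Type) (l : seq I) (f : I -> V) : A (\sum_(i <- l) f i) = \sum_(i <- l) A (f i).
Proof. by elim: l => [|i l IH]; rewrite ?big_nil ?op0 // !big_cons opD IH. Qed.
End Linearity.

Lemma complete_seq V (u : nat -> V) (e : nat -> R) :
  (forall n j, (n <= j)%N -> nrm (u j - u n) <= e n) ->
  (forall d, 0 < d -> exists n, e n < d) ->
  exists l, forall n, nrm (u n - l) <= e n.
Proof.
move=> ue e0.
have eps_pos (eps : scalars R s) : 0 < eps -> eps = scal s (scalar_Re eps) /\ 0 < scalar_Re eps.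
  move=> p; have E := ge0_scal (ltW p); split=> //.
  by rewrite -(@ltr_scal R s) -E scal0.
have : cauchy (u @ \oo).
  apply: cauchy_exP => eps /eps_pos[E p]; have [n nd] := e0 _ p.
  exists (u n); exists n => // j /= nj; rewrite -ball_normE /=.
  by rewrite E normE ltr_scal nrm_distC (le_lt_trans (ue _ _ nj)).
move=> /cauchy_cvgP/cvg_ex[l /= ul].
exists l => n; apply/ler_addgt0Pr => d d0.
have sd : 0 < scal s d by rewrite -(scal0 R s) ltr_scal.
have /cvgrPdist_le/(_ _ sd)[N _ HN] := ul.
have := HN (maxn n N) (leq_maxr _ _); rewrite normE ler_scal => h1.
have := ue n (maxn n N) (leq_maxl _ _) => h2.
rewrite nrm_distC -(subrK (u (maxn n N)) l) -addrA.
by apply: le_trans (nrmD _ _) _; lra.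
Qed.

(* pointwise limit of operators *)
(** The pointwise limit of an operator-norm Cauchy sequence is linear and is
    approached at the same rate. *)
Lemma complete_op V W (T : nat -> boundedOp V W) (e : nat -> R) :
  (forall n j x, (n <= j)%N -> nrm (T j x - T n x) <= e n * nrm x) ->
  (forall d, 0 < d -> exists n, e n < d) ->
  exists S : boundedOp V W, forall n x, nrm (T n x - S x) <= e n * nrm x.
Proof.
move=> Te e0.
have small D t : 0 <= D -> (forall n, t <= e n * D) -> t <= 0.
  move=> D0 tD; apply/ler_addgt0Pr => d d0; rewrite add0r.
  have D1 : 0 < D + 1 by rewrite ltr_wpDl.
  have [n] := e0 _ (divr_gt0 d0 D1); rewrite ltr_pdivlMr// => h.
  apply: le_trans (tD n) _; have [?|?] := leP 0 (e n); nra.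
have ex x : exists l, forall n, nrm (T n x - l) <= e n * nrm x.
  apply: complete_seq => [n j nj|d d0]; first exact: Te.
  apply: contrapT => H; have : d <= 0; last by rewrite leNgt d0.
  apply: (@small (nrm x)) => [|n]; first exact: nrm_ge0.
  by rewrite leNgt; apply/negP => h; apply: H; exists n.
have [f fP] := choice ex.
have f_lin : linear f.
  move=> a x y; apply/eqP; rewrite -subr_eq0; apply/eqP/nrm0_eq0/le_anti.
  rewrite nrm_ge0 andbT.
  have a0 : 0 <= scalar_Re `|a| by rewrite -(@scal_ge0 R s) -ge0_scal.
  apply: (@small (nrm (a *: x + y) + scalar_Re `|a| * nrm x + nrm y)) => [|n].
    by rewrite !addr_ge0 ?mulr_ge0 ?nrm_ge0.
  have -> : f (a *: x + y) - (a *: f x + f y) =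
     - (T n (a *: x + y) - f (a *: x + y)) + (a *: (T n x - f x) + (T n y - f y)).
    by rewrite opD opZ scalerBr opprB (addrACA (a *: T n x)) -opprD addrA subrK.
  have h0 := nrmD (- (T n (a *: x + y) - f (a *: x + y))) (a *: (T n x - f x) + (T n y - f y)).
  have h1 := fP (a *: x + y) n; have h2 := nrmD (a *: (T n x - f x)) (T n y - f y).
  have h4 := fP y n; have h5 := ler_wpM2l a0 (fP x n).
  rewrite nrmN in h0; rewrite nrmZ in h2.
  by rewrite !mulrDr [e n * (_ * _)]mulrCA; lra.
have [M M0 HM] := op_bound (T 0%N).
have fM x : nrm (f x) <= (M + e 0%N) * nrm x.
  rewrite -[f x](subrK (T 0%N x)); apply: le_trans (nrmD _ _) _.
  by rewrite nrm_distC; have := fP x 0%N; have := HM x; lra.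
by have [S SE] := op_of_linear f_lin fM; exists S => n x; rewrite SE.
Qed.

End Operators.

(** * The operator norm *)

Section OpNorm.
Variables (R : realType) (s : scalar_kind) (K H : hilbertType R s).
Implicit Types A : boundedOp K H.

Lemma opnorm_le A c : 0 <= c -> (forall x, nrm (A x) <= c * nrm x) -> opnorm A <= c.
Proof.
move=> c0 Ac; apply: ge_sup; first by exists (nrm (A 0)); exists 0 => //=; rewrite normr0.
move=> _ [x /= x1 <-]; apply: le_trans (Ac x) _.
by rewrite ler_piMr// -(@ler_scal R s) -normE scal1.
Qed.

Lemma opnorm_bound A x : nrm (A x) <= opnorm A * nrm x.
Proof.
have [/nrm0_eq0->|nx] := eqVneq (nrm x) 0; first by rewrite op0 !nrm0 mulr0.
have nx0 : 0 < nrm x by rewrite lt0r nx nrm_ge0.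
rewrite -ler_pdivrMr// mulrC.
have -> : (nrm x)^-1 * nrm (A x) = nrm (A (scal s (nrm x)^-1 *: x)).
  by rewrite opZ nrmZr ger0_norm// invr_ge0 nrm_ge0.
have [M M0 AM] := op_bound A.
apply: ub_le_sup; last first.
  exists (scal s (nrm x)^-1 *: x) => //=.
  by rewrite normE nrmZr ger0_norm ?invr_ge0 ?nrm_ge0// mulVf// scal1.
exists M => _ [y /= y1 <-]; apply: le_trans (AM y) _.
by rewrite ler_piMr// -(@ler_scal R s) -normE scal1.
Qed.

Lemma opnorm_ge0 A : 0 <= opnorm A.
Proof.
have [M M0 AM] := op_bound A.
apply: (@le_trans _ _ (nrm (A 0))); first exact: nrm_ge0.
apply: ub_le_sup; last by exists 0 => //=; rewrite normr0.
exists M => _ [y /= y1 <-]; apply: le_trans (AM y) _.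
by rewrite ler_piMr// -(@ler_scal R s) -normE scal1.
Qed.

Lemma opnormN A : opnorm (- A) = opnorm A.
Proof.
have h (B : boundedOp K H) : opnorm (- B) <= opnorm B.
  by apply: opnorm_le => [|x]; rewrite ?opnorm_ge0// oppopE nrmN opnorm_bound.
by apply/le_anti; rewrite h -[leLHS](congr1 (@opnorm _ _ _ _) (opprK A)) h.
Qed.

End OpNorm.

(** * Inverses, square roots and adjoints *)

Section Adjoints.
Variables (R : realType) (s : scalar_kind).
Implicit Types V W K H : hilbertType R s.

Lemma innerC V (x y : V) : inner x y = scalar_conj (inner y x).
Proof. by rewrite (@hermitian_subproof _ _ _ _ (@inner R s V)) expr0 mul1r. Qed.
Lemma innerZl V a (x y : V) : inner (a *: x) y = a * inner x y.
Proof. by rewrite linearZl_LR. Qed.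
Lemma innerZr V a (x y : V) : inner x (a *: y) = scalar_conj a * inner x y.
Proof. by rewrite linearZr_LR. Qed.

(** An adjunction for the real inner products is one for the scalar-valued
    ones: multiplying x by the conjugate of the defect makes the defect real
    and nonnegative. *)
Lemma adjoint_rin V W (A : boundedOp V W) (B : boundedOp W V) :
  (forall x y, rin (A x) y = rin x (B y)) ->
  forall x y, inner (A x) y = inner x (B y).
Proof.
move=> AB x y; apply/eqP; rewrite -subr_eq0; set d := _ - _.
have := AB (scalar_conj d *: x) y.
rewrite opZ /rin !innerZl => /eqP; rewrite -subr_eq0 -scalar_ReN -scalar_ReD -mulrBr.
rewrite mul_scalar_conj (ge0_scal (normr_ge0 d)) expr2 -scalM scal_Re.
rewrite mulf_eq0 orbb => /eqP h; rewrite -normr_eq0 (ge0_scal (normr_ge0 d)) h.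
by rewrite scal0.
Qed.

Definition selfadjoint V (T : boundedOp V V) := forall x y, inner (T x) y = inner x (T y).

Lemma positive_opP V (T : boundedOp V V) :
  selfadjoint T -> (forall x, 0 <= rin (T x) x) -> positive_op T.
Proof.
move=> sT T0; split=> // x; set a := inner (T x) x.
have : scalar_conj a = a by rewrite -innerC -sT.
have := T0 x; rewrite /rin -/a; move: a.
clear; case: s => //= -[a b] /= a0 [bb].
by rewrite lecE /= a0 andbT; apply/eqP; lra.
Qed.

(** Closedness in operator norm, with the norm bound spelled out so that no
    supremum has to be handled. *)
Definition op_closed V W (P : boundedOp V W -> Prop) :=
  forall Y : boundedOp V W, (forall d, 0 < d -> exists2 Z : boundedOp V W, P Z & forall x, nrm (Z x - Y x) <= d * nrm x) -> P Y.

Lemma le0_small (t D : R) : 0 <= D -> (forall d, 0 < d -> t <= d * D) -> t <= 0.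
Proof.
move=> D0 tD; apply/ler_addgt0Pr => d d0; rewrite add0r.
have D1 : 0 < D + 1 by rewrite ltr_wpDl.
apply: le_trans (tD _ (divr_gt0 d0 D1)) _.
by rewrite mulrAC ler_pdivrMr// ler_pM2l// lerDl.
Qed.

Lemma op_closed_bound V W q : op_closed (fun Y : boundedOp V W => forall x, nrm (Y x) <= q * nrm x).
Proof.
move=> Y HY x; rewrite -subr_le0; apply: (@le0_small _ (nrm x)); first exact: nrm_ge0.
move=> d /HY[Z Zq ZY]; have := Zq x; have := ZY x.
rewrite nrm_distC; have := nrmD (Y x - Z x) (Z x); rewrite subrK; lra.
Qed.

Lemma op_closed_selfadjoint V : op_closed (@selfadjoint V).
Proof.
move=> Y HY; apply: adjoint_rin => x y; apply/eqP; rewrite -subr_eq0 -normr_le0.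
apply: (@le0_small _ (2 * (nrm x * nrm y))).
  by rewrite !mulr_ge0 ?nrm_ge0.
move=> d /HY[Z Zs ZY].
have -> : rin (Y x) y - rin x (Y y) = rin x (Z y - Y y) - rin (Z x - Y x) y.
  by rewrite rinBl rinBr /rin Zs; lra.
have h1 := ler_wpM2r (nrm_ge0 y) (ZY x); have h2 := ler_wpM2l (nrm_ge0 x) (ZY y).
have h3 := rin_le x (Z y - Y y); have h4 := rin_le (Z x - Y x) y.
have h5 := rin_le x (-(Z y - Y y)); have h6 := rin_le (-(Z x - Y x)) y.
rewrite rinNr nrmN in h5; rewrite rinNl nrmN in h6.
by rewrite ler_norml; apply/andP; split; lra.
Qed.

(** Banach's fixed point theorem for operators.  The set P restricts the
    region on which Phi has to be contracting, and records properties of the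
    iterates that survive in the fixed point. *)
Lemma op_contraction V (Phi : boundedOp V V -> boundedOp V V)
    (P : boundedOp V V -> Prop) (q : R) :
  0 <= q < 1 -> op_closed P -> P 0 -> (forall Y, P Y -> P (Phi Y)) ->
  (forall Y Z c, P Y -> P Z -> 0 <= c -> (forall x, nrm (Y x - Z x) <= c * nrm x) ->
     forall x, nrm (Phi Y x - Phi Z x) <= q * c * nrm x) ->
  exists2 S, P S & Phi S = S.
Proof.
move=> /andP[q0 q1] Pc P0 PPhi PhiC.
pose Y n := iter n Phi 0.
have PY n : P (Y n) by elim: n => //= n; exact: PPhi.
have [C C0 HC] := op_bound (Y 1%N).
have step n x : nrm (Y n.+1 x - Y n x) <= q ^+ n * C * nrm x.
  elim: n x => [x|n IH x].
    by rewrite expr0 mul1r /= subr0; exact: HC.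
  rewrite exprS -(mulrA q); apply: (PhiC (Y n.+1) (Y n) (q ^+ n * C) (PY _) (PY _) _ IH x).
  by rewrite mulr_ge0 ?exprn_ge0.
have q1' : 0 < 1 - q by rewrite subr_gt0.
pose e n := C / (1 - q) * q ^+ n.
have CC : 0 <= C / (1 - q) by rewrite divr_ge0 // ltW.
have dist n k x : nrm (Y (n + k)%N x - Y n x) <= C / (1 - q) * (q ^+ n - q ^+ (n + k)) * nrm x.
  elim: k => [|k IH]; first by rewrite addn0 !subrr nrm0 mulr0 mul0r.
  rewrite addnS; have := nrmD (Y (n + k).+1 x - Y (n + k)%N x) (Y (n + k)%N x - Y n x).
  rewrite addrA subrK; have := step (n + k)%N x.
  have -> : q ^+ (n + k) * C = C / (1 - q) * (q ^+ (n + k) - q ^+ (n + k).+1).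
    by rewrite exprS; field; rewrite gt_eqF.
  lra.
have e_small d : 0 < d -> exists n, e n < d.
  move=> d0; have : q ^+ n @[n --> \oo] --> 0 by apply: cvg_expr; rewrite ger0_norm.
  have CC1 : 0 < C / (1 - q) + 1 by rewrite ltr_wpDl.
  move=> /cvgrPdist_lt/(_ _ (divr_gt0 d0 CC1))[N _ /(_ N (leqnn _))].
  rewrite /= sub0r normrN ger0_norm ?exprn_ge0// ltr_pdivlMr// => h.
  exists N; rewrite /e; have := exprn_ge0 N q0; nra.
have [S SP] : exists S : boundedOp V V, forall n x, nrm (Y n x - S x) <= e n * nrm x.
  apply: complete_op e_small => n j x /subnKC <-.
  apply: le_trans (dist _ _ _) _; rewrite ler_wpM2r ?nrm_ge0//.
  by rewrite /e ler_wpM2l// lerBlDr lerDl exprn_ge0.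
have e0 n : 0 <= e n by rewrite mulr_ge0 ?exprn_ge0.
have PS : P S.
  apply: Pc => d /e_small[n nd]; exists (Y n) => // x.
  by apply: le_trans (SP n x) _; rewrite ler_wpM2r ?nrm_ge0// ltW.
exists S => //; apply: op_ext => x; apply/eqP; rewrite -subr_eq0; apply/eqP/nrm0_eq0/le_anti.
rewrite nrm_ge0 andbT; apply: (@le0_small _ (2 * nrm x)).
  by rewrite mulr_ge0 ?nrm_ge0.
move=> d /e_small[n nd].
have h1 : nrm (Y n.+1 x - Phi S x) <= q * e n * nrm x := PhiC _ _ _ (PY n) PS (e0 n) (SP n) x.
have h2 := SP n.+1 x.
have := nrmD (- (Y n.+1 x - Phi S x)) (Y n.+1 x - S x).
rewrite nrmN opprB addrA subrK => h3; apply: le_trans h3 _.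
have h4 : e n.+1 <= e n by rewrite /e ler_wpM2l// exprS ler_piMl ?exprn_ge0// ltW.
have nx := nrm_ge0 x; have h5 := ler_wpM2r nx h4.
have h6 := ler_wpM2r nx (ltW nd).
have h7 := ler_wpM2r nx (ler_wpM2r (e0 n) (ltW q1)); lra.
Qed.

(** The right inverse of 1 - T is the fixed point of Z |-> 1 + T Z; it is also a
    left inverse because 1 - T is injective. *)
Lemma op_neumann V (T : boundedOp V V) (q : R) : 0 <= q < 1 ->
  (forall x, nrm (T x) <= q * nrm x) ->
  exists Z : boundedOp V V, Z \c (idop V - T) = idop V /\ (idop V - T) \c Z = idop V.
Proof.
move=> q01 Tq.
have [] := @op_contraction V (fun Z => idop V + T \c Z) (fun=> True) q q01 => //.
  move=> Y Z c _ _ c0 YZ x; rewrite !addopE !compopE /= opprD addrACA subrr add0r -opB.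
  apply: le_trans (Tq _) _; rewrite -mulrA ler_wpM2l//; by case/andP: q01.
move=> Z _ ZE; exists Z.
have right x : Z x - T (Z x) = x.
  by rewrite -{1}ZE addopE compopE /= addrK.
split; apply: op_ext => x; rewrite compopE addopE oppopE; last exact: right.
rewrite -[idop V x]/x.
apply/eqP; rewrite -subr_eq0; apply/eqP/nrm0_eq0/le_anti; rewrite nrm_ge0 andbT.
set y := Z _ - x; have yT : T y = y.
  have := right (x - T x); rewrite /y; set u := Z _ => h.
  have E : T u = u - (x - T x) by rewrite -h opprB addrCA subrr addr0.
  by rewrite opB E opprB addrCA addrAC subrr add0r.
have := Tq y; rewrite yT; have := nrm_ge0 y; case/andP: q01 => *; nra.
Qed.

(** (1 - Y)^2 = 1 - T means Y = (T + Y^2)/2, and the right-hand side is a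
    contraction with constant q of the ball of radius q.  Self-adjointness of T
    passes to all iterates. *)
Lemma op_sqrt V (T : boundedOp V V) (q : R) : 0 <= q < 1 -> selfadjoint T ->
  (forall x, nrm (T x) <= q * nrm x) ->
  exists S : boundedOp V V, positive_op S /\ S \c S = idop V - T.
Proof.
move=> q01 Ts Tq; have /andP[q0 q1] := q01.
have [] := @op_contraction V (fun Y => scal s 2^-1 *: (T + Y \c Y))
  (fun Y => selfadjoint Y /\ forall x, nrm (Y x) <= q * nrm x) q q01 => //.
- move=> Y HY; split.
    by apply: op_closed_selfadjoint => d /HY[Z []]; exists Z.
  by apply: op_closed_bound => d /HY[Z []]; exists Z.
- split=> x; first by move=> y; rewrite linear0l linear0r.
  by rewrite nrm0 mulr_ge0 ?nrm_ge0.
- move=> Y [Ys Yq]; split=> [x y|x]; rewrite !(scaleopE, addopE, compopE).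
    by rewrite innerZl innerZr scal_conj; congr (_ * _); rewrite linearDl /= [RHS]linearDr /= Ts !Ys.
  rewrite nrmZr ger0_norm ?invr_ge0//.
  have := nrmD (T x) (Y (Y x)); have := Tq x; have := Yq (Y x).
  have := ler_wpM2l q0 (Yq x).
  have := ler_wpM2l q0 (ler_piMl (nrm_ge0 x) (ltW q1)); lra.
- move=> Y Z c [_ Yq] [_ Zq] c0 YZ x; rewrite !scaleopE -scalerBr !addopE !compopE.
  rewrite opprD addrACA subrr add0r nrmZr ger0_norm ?invr_ge0//.
  have -> : Y (Y x) - Z (Z x) = Y (Y x - Z x) + (Y (Z x) - Z (Z x)).
    by rewrite opB addrA subrK.
  have := nrmD (Y (Y x - Z x)) (Y (Z x) - Z (Z x)).
  have := ler_wpM2l q0 (YZ x); have := Yq (Y x - Z x); have := YZ (Z x).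
  have := ler_wpM2l c0 (Zq x); lra.
move=> Y [Ys Yq] YE; exists (idop V - Y); split.
  apply: positive_opP => [x y|x]; rewrite addopE oppopE /=.
    by rewrite linearBl linearBr /= Ys.
  rewrite rinBl rin_nrm; have := rin_le (Y x) x.
  by have := ler_wpM2r (nrm_ge0 x) (Yq x); have := nrm_ge0 x; nra.
apply: op_ext => x; rewrite compopE !addopE !oppopE /= opB.
have : 2%:R *: Y x = T x + Y (Y x).
  rewrite -{1}YE scaleopE addopE compopE scalerA -(@scal_nat R s) -scalM.
  by rewrite divff// scal1 scale1r.
rewrite scaler_nat mulr2n => h.
have -> : T x = Y x + Y x - Y (Y x) by rewrite h addrK.
by rewrite !opprB opprD -addrA [- Y x + (_ + _)]addrCA.
Qed.

(** The orthogonal projection on the span of f when f is orthonormal; zero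
    vectors in f are harmless, which spares a case distinction in
    Gram-Schmidt. *)
Definition proj_frame V (f : seq V) (x : V) : V := \sum_(v <- f) inner x v *: v.

Lemma proj_frame_sym V (f : seq V) x y :
  inner (proj_frame f x) y = inner x (proj_frame f y).
Proof.
rewrite /proj_frame linear_sumlz linear_sumr; apply: eq_bigr => v _ /=.
by rewrite innerZl innerZr -innerC mulrC.
Qed.

(** Gram-Schmidt.  An added vector e contributes its normalised component g
    orthogonal to the vectors already present, or the vector 0 if e lies in
    their span. *)
Lemma frame_exists V (es : seq V) : exists f : seq V,
  {in f, forall x, proj_frame f x = x} /\ {in es, forall x, proj_frame f x = x}.
Proof.
elim: es => [|e es [f [ff fe]]]; first by exists [::].
pose g := e - proj_frame f e; pose f0 := scal s (nrm g)^-1 *: g.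
have gv v : v \in f -> inner g v = 0.
  by move=> vf; rewrite linearBl /= proj_frame_sym ff// subrr.
have Pf0 : proj_frame f f0 = 0.
  by rewrite /proj_frame big_seq big1// => v vf; rewrite innerZl gv// mulr0 scale0r.
have conj0 : scalar_conj (0 : scalars R s) = 0 by rewrite -(scal0 R s) scal_conj.
have vf0 v : proj_frame f v = v -> inner v f0 = 0.
  by move=> <-; rewrite proj_frame_sym Pf0 linear0r.
have P'E x : proj_frame (f0 :: f) x = inner x f0 *: f0 + proj_frame f x.
  by rewrite /proj_frame big_cons.
have gg : inner g f0 *: f0 = g.
  have [g0|/eqP g0] := eqVneq (nrm g) 0.
    by rewrite /f0 (nrm0_eq0 g0) !scaler0.
  rewrite innerZr scal_conj inner_normE normE expr2 -!scalM mulrA mulVf ?mul1r; last exact/eqP.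
  by rewrite scalerA -scalM divff ?scal1 ?scale1r //; exact/eqP.
have f0f0 : inner f0 f0 *: f0 = f0.
  by rewrite {1}/f0 innerZl -scalerA gg.
exists (f0 :: f); split=> x; rewrite inE => /predU1P[->|xf]; rewrite P'E.
- by rewrite f0f0 Pf0 addr0.
- by rewrite vf0 ?scale0r ?add0r ?ff.
- have -> : inner e f0 = inner g f0.
    by rewrite linearBl /= proj_frame_sym Pf0 linear0r subr0.
  by rewrite gg subrK.
- by rewrite vf0 ?scale0r ?add0r ?fe.
Qed.

Definition parseval_frame V (f : seq V) := forall x, proj_frame f x = x.

Lemma finite_dimensional_frame K : finite_dimensional K -> exists f : seq K, parseval_frame f.
Proof.
move=> [n [e eK]]; have [f [_ fe]] := frame_exists (codom e).
exists f => x; have [c ->] := eK x.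
rewrite /proj_frame; under eq_bigr do rewrite linear_sumlz scaler_suml.
rewrite exchange_big; apply: eq_bigr => i _.
under eq_bigr => v _ do rewrite [X in X *: _](innerZl (c i) (e i) v) -scalerA.
by rewrite -scaler_sumr; congr (_ *: _); apply: fe; exact: codom_f.
Qed.

Lemma nrm_sum V (I : Type) (l : seq I) (f : I -> V) :
  nrm (\sum_(i <- l) f i) <= \sum_(i <- l) nrm (f i).
Proof.
elim: l => [|i l IH]; first by rewrite !big_nil nrm0.
by rewrite !big_cons; apply: le_trans (nrmD _ _) _; rewrite lerD.
Qed.

(** Explicitly, B y is the sum of <y, A v> v over the frame. *)
Lemma adjoint_exists K H (A : boundedOp K H) : finite_dimensional K ->
  exists B : boundedOp H K, forall x y, inner (A x) y = inner x (B y).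
Proof.
move=> /finite_dimensional_frame[f fK].
pose B y := \sum_(v <- f) inner y (A v) *: v.
have Bl : linear B.
  move=> a x y; rewrite /B scaler_sumr -big_split; apply: eq_bigr => v _ /=.
  by rewrite linearDl /= innerZl scalerDl scalerA.
have BM y : nrm (B y) <= (\sum_(v <- f) nrm (A v) * nrm v) * nrm y.
  rewrite /B mulr_suml; apply: le_trans (nrm_sum _ _) _; apply: ler_sum => v _.
  rewrite nrmZ mulrAC ler_wpM2r ?nrm_ge0// mulrC; exact: norm_inner_le.
have [B' B'E] := op_of_linear Bl BM; exists B' => x y; rewrite B'E -{1}(fK x) op_sum linear_sumlz.
rewrite linear_sumr; apply: eq_bigr => v _ /=.
by rewrite opZ innerZl innerZr -innerC mulrC.
Qed.

End Adjoints.

(** * Rho-balls are described by quadratic inequalities *)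

Section Mobius.
Variables (R : realType) (s : scalar_kind) (K H : hilbertType R s).
Hypothesis finK : finite_dimensional K.
Implicit Types A B C X : boundedOp K H.

(** The relation sinh(rho(B, X))^2 <= mu; see [mobius_le]. *)
Definition sinh2_le (mu : R) X B := forall v u,
  nrm (X v - B u) ^+ 2 + mu * nrm (X v) ^+ 2 <= nrm (v - u) ^+ 2 + mu * nrm v ^+ 2.

Lemma adjointP A x y : inner (A x) y = inner x (adjoint A y).
Proof. exact: (xgetPex 0 (adjoint_exists A finK)). Qed.

Lemma adjoint_rinP A x y : rin (A x) y = rin x (adjoint A y).
Proof. by rewrite /rin adjointP. Qed.

Lemma adjoint_bound A y : nrm (adjoint A y) <= opnorm A * nrm y.
Proof.
set z := adjoint A y.
have [->|nz] := eqVneq (nrm z) 0; first by rewrite mulr_ge0 ?opnorm_ge0 ?nrm_ge0.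
have z0 : 0 < nrm z by rewrite lt0r nz nrm_ge0.
rewrite -(ler_pM2l z0) -expr2 -rin_nrm {2}/z -adjoint_rinP.
apply: le_trans (rin_le _ _) _.
by rewrite mulrCA mulrA ler_wpM2r ?nrm_ge0// opnorm_bound.
Qed.

Lemma invopP (V : hilbertType R s) (T : boundedOp V V) : (exists S : boundedOp V V, S \c T = idop V /\ T \c S = idop V) ->
  invop T \c T = idop V /\ T \c invop T = idop V.
Proof.
by move=> [S [S1 S2]]; apply: (@xgetPex _ 0 [set S : boundedOp V V | S \c T = idop V /\ T \c S = idop V]); exists S.
Qed.

Lemma sqrt_pointwise (V : hilbertType R s) (S T : boundedOp V V) x : S \c S = idop V - T -> S (S x) = x - T x.
Proof. by move=> /(congr1 (fun A : boundedOp V V => A x)). Qed.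

Section Geometry.
Variables (C B : boundedOp K H).
Hypotheses (C1 : opnorm C < 1) (B1 : opnorm B < 1).

Let Cs := adjoint C.
Let SK := sqrtop (idop K - Cs \c C).
Let SH := sqrtop (idop H - C \c Cs).

Let c01 : 0 <= opnorm C ^+ 2 < 1.
Proof. by rewrite exprn_ge0 ?opnorm_ge0// exprn_ilt1 ?opnorm_ge0. Qed.

Let CsC_bound x : nrm ((Cs \c C) x) <= opnorm C ^+ 2 * nrm x.
Proof.
rewrite compopE; apply: le_trans (adjoint_bound _ _) _.
by rewrite expr2 -mulrA ler_wpM2l ?opnorm_ge0 ?opnorm_bound.
Qed.

Let CCs_bound x : nrm ((C \c Cs) x) <= opnorm C ^+ 2 * nrm x.
Proof.
rewrite compopE; apply: le_trans (opnorm_bound _ _) _.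
by rewrite expr2 -mulrA ler_wpM2l ?opnorm_ge0 ?adjoint_bound.
Qed.

Let SKP : positive_op SK /\ SK \c SK = idop K - Cs \c C.
Proof.
apply: (@xgetPex _ 0 [set S : boundedOp K K | positive_op S /\ S \c S = idop K - Cs \c C]).
apply: op_sqrt c01 _ CsC_bound => x y.
by rewrite !compopE -adjointP innerC -adjointP -innerC.
Qed.

Let SHP : positive_op SH /\ SH \c SH = idop H - C \c Cs.
Proof.
apply: (@xgetPex _ 0 [set S : boundedOp H H | positive_op S /\ S \c S = idop H - C \c Cs]).
apply: op_sqrt c01 _ CCs_bound => x y.
by rewrite !compopE adjointP [RHS]innerC adjointP -innerC.
Qed.

Let SK2 x : SK (SK x) = x - Cs (C x).
Proof. by rewrite (sqrt_pointwise _ SKP.2). Qed.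
Let SH2 x : SH (SH x) = x - C (Cs x).
Proof. by rewrite (sqrt_pointwise _ SHP.2). Qed.

(** S has the two-sided inverse S Z, where Z inverts S S = 1 - T. *)
Lemma sq_invertible (V : hilbertType R s) (S T : boundedOp V V) q : 0 <= q < 1 ->
  (forall x, nrm (T x) <= q * nrm x) -> S \c S = idop V - T ->
  exists Q : boundedOp V V, Q \c S = idop V /\ S \c Q = idop V.
Proof.
move=> q01 Tq S2; have [Z] := op_neumann q01 Tq; rewrite -S2 => -[ZS SZ].
have ZSx x : Z (S (S x)) = x by have := congr1 (fun A : boundedOp V V => A x) ZS.
have SZx x : S (S (Z x)) = x by have := congr1 (fun A : boundedOp V V => A x) SZ.
exists (S \c Z); split; apply: op_ext => x; rewrite !compopE /=; last exact: SZx.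
by rewrite -[LHS]ZSx SZx ZSx.
Qed.

(** The vectors v and w correspond under the hyperbolic rotation: with
    h = B v + C w one has v = w - C' h and B v = h - C w.  Then SK w and SH h are
    the components of the rotated graph vector (v, B v), so that
    mobius C B maps SK w to SH h ([linked_mobius]). *)
Definition linked v w := w - Cs (C w) = v + Cs (B v).

Lemma linked_mobius v w : linked v w -> mobius C B (SK w) = SH (B v + C w).
Proof.
move=> vw; rewrite /mobius -/Cs -/SK -/SH !compopE SK2 vw.
have [inv1 _] : invop (idop K + Cs \c B) \c (idop K + Cs \c B) = idop K /\
    (idop K + Cs \c B) \c invop (idop K + Cs \c B) = idop K.
  apply: invopP; rewrite -[Cs \c B]opprK.
  apply: (@op_neumann _ _ _ _ (opnorm C)); first by rewrite opnorm_ge0.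
  move=> x; rewrite oppopE nrmN compopE; apply: le_trans (adjoint_bound _ _) _.
  rewrite ler_wpM2l ?opnorm_ge0//; apply: le_trans (opnorm_bound _ _) _.
  by rewrite ler_piMl ?nrm_ge0 ?ltW.
have {inv1} -> : invop (idop K + Cs \c B) (v + Cs (B v)) = v.
  by have := congr1 (fun A : boundedOp K K => A v) inv1; rewrite compopE.
have [inv _] : invop SH \c SH = idop H /\ SH \c invop SH = idop H.
  by apply: invopP; apply: sq_invertible c01 CCs_bound SHP.2.
have -> : (C + B) v = SH (SH (B v + C w)).
  have e : Cs (B v + C w) = w - v.
    by rewrite opD -[w in RHS](subrK (Cs (C w))) vw [RHS]addrC -(addrA v) addKr.
  by rewrite SH2 e addopE opB opprB [RHS]addrC addrA addrAC subrK.
by have := congr1 (fun A : boundedOp H H => A (SH (B v + C w))) inv; rewrite compopE.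
Qed.

Lemma SK_norm w : nrm (SK w) ^+ 2 = nrm w ^+ 2 - nrm (C w) ^+ 2.
Proof.
have <- : rin w (SK (SK w)) = nrm (SK w) ^+ 2.
  by rewrite -rin_nrm /rin SKP.1.1.
by rewrite SK2 rinBr rin_nrm -adjoint_rinP rin_nrm.
Qed.

Lemma SH_norm h : nrm (SH h) ^+ 2 = nrm h ^+ 2 - nrm (Cs h) ^+ 2.
Proof.
have <- : rin h (SH (SH h)) = nrm (SH h) ^+ 2 by rewrite -rin_nrm /rin SHP.1.1.
by rewrite SH2 rinBr rin_nrm rinC adjoint_rinP rin_nrm.
Qed.

(** Invariance of the indefinite form under the rotation: the cross terms
    cancel because <w, C' h> = <C w, h>. *)
Lemma linked_form v w : linked v w ->
  nrm (SK w) ^+ 2 - nrm (SH (B v + C w)) ^+ 2 = nrm v ^+ 2 - nrm (B v) ^+ 2.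
Proof.
move=> vw; rewrite SK_norm SH_norm.
have hv : nrm v = nrm (w - Cs (B v + C w)).
  by rewrite opD opprD addrA addrAC vw addrK.
have hB : nrm (B v) = nrm ((B v + C w) - C w) by rewrite addrK.
rewrite hv [in RHS]hB !nrmB_sq -adjoint_rinP (rinC (C w)); lra.
Qed.

Lemma linked_exists_l v : exists w, linked v w.
Proof.
have [Z [_ HZ]] := op_neumann c01 CsC_bound.
exists (Z (v + Cs (B v))).
by have := congr1 (fun A : boundedOp K K => A (v + Cs (B v))) HZ.
Qed.

Lemma linked_exists_r x : exists v w, x = SK w /\ linked v w.
Proof.
have [Q [_ SQ]] := sq_invertible c01 CsC_bound SKP.2.
have [Z [_ HZ]] : exists Z : boundedOp K K, Z \c (idop K - (- (Cs \c B))) = idop K /\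
    (idop K - (- (Cs \c B))) \c Z = idop K.
  apply: (@op_neumann _ _ _ _ (opnorm C)); first by rewrite opnorm_ge0.
  move=> y; rewrite oppopE nrmN compopE; apply: le_trans (adjoint_bound _ _) _.
  rewrite ler_wpM2l ?opnorm_ge0//; apply: le_trans (opnorm_bound _ _) _.
  by rewrite ler_piMl ?nrm_ge0 ?ltW.
exists (Z (SK x)), (Q x); split.
  by have := congr1 (fun A : boundedOp K K => A x) SQ.
rewrite /linked -SK2.
have -> : SK (Q x) = x by have := congr1 (fun A : boundedOp K K => A x) SQ.
by have := congr1 (fun A : boundedOp K K => A (SK x)) HZ; rewrite opprK.
Qed.

(** For linked v and w, |mobius C B| <= t at SK w reads
    (1 - t^2) |SK w|^2 <= |v|^2 - |B v|^2 by [linked_form].  On the left,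
    |SK w|^2 is the maximum over u of 2 <v + C' B v, u> - |u|^2 + |C u|^2,
    attained at u = w; this brings in the second variable. *)
Lemma mobius_le t : 0 <= t < 1 ->
  opnorm (mobius C B) <= t <-> sinh2_le (t ^+ 2 / (1 - t ^+ 2)) B (- C).
Proof.
move=> /andP[t0 t1]; have t2 : 0 < 1 - t ^+ 2 by rewrite subr_gt0 exprn_ilt1.
have key v w : linked v w ->
  (nrm (mobius C B (SK w)) <= t * nrm (SK w)) =
  ((1 - t ^+ 2) * (nrm w ^+ 2 - nrm (C w) ^+ 2) <= nrm v ^+ 2 - nrm (B v) ^+ 2).
  move=> vw; rewrite -(linked_form vw) (linked_mobius vw) -SK_norm.
  rewrite -[LHS](@ler_pXn2r _ 2) ?nnegrE ?mulr_ge0 ?nrm_ge0// exprMn.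
  by apply/idP/idP; lra.
have form v u : (nrm (B v - (- C) u) ^+ 2 + t ^+ 2 / (1 - t ^+ 2) * nrm (B v) ^+ 2 <=
     nrm (v - u) ^+ 2 + t ^+ 2 / (1 - t ^+ 2) * nrm v ^+ 2) =
  ((1 - t ^+ 2) * (2 * rin (v + Cs (B v)) u - nrm u ^+ 2 + nrm (C u) ^+ 2)
     <= nrm v ^+ 2 - nrm (B v) ^+ 2).
  have hmu : (1 - t ^+ 2) * (t ^+ 2 / (1 - t ^+ 2)) = t ^+ 2 by rewrite mulrC divfK ?gt_eqF.
  rewrite -(ler_pM2l t2) ![(1 - t ^+ 2) * (_ + _ * _)]mulrDr !(mulrA (1 - t ^+ 2) (t ^+ 2 / _)) hmu oppopE opprK nrmD_sq nrmB_sq rinDl.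
  by rewrite [rin (Cs (B v)) u]rinC -adjoint_rinP (rinC (C u)); apply/idP/idP; lra.
split=> [Mt v u|W].
  have [w vw] := linked_exists_l v; rewrite form.
  have := key _ _ vw; rewrite (le_trans (opnorm_bound _ _)) ?ler_wpM2r ?nrm_ge0// => /esym h.
  apply: le_trans h; rewrite ler_pM2l// -vw rinBl.
  have e : rin (Cs (C w)) u = rin (C w) (C u) by rewrite rinC -adjoint_rinP rinC.
  rewrite e; have := sqr_ge0 (nrm (w - u)); have := opnorm_bound C (w - u).
  have := nrm_ge0 (w - u); have := nrm_ge0 (C (w - u)) => n1 n2 n3 _.
  have : nrm (C (w - u)) ^+ 2 <= nrm (w - u) ^+ 2.
    rewrite lerXn2r ?nnegrE//; apply: le_trans n3 _.
    by rewrite ler_piMl// ltW.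
  rewrite opB !nrmB_sq; lra.
apply: opnorm_le => // x; have [v [w [-> vw]]] := linked_exists_r x.
rewrite (key _ _ vw); have := W v w; rewrite form; apply: le_trans.
rewrite ler_pM2l// -vw rinBl rin_nrm.
have -> : rin (Cs (C w)) w = nrm (C w) ^+ 2 by rewrite rinC -adjoint_rinP rin_nrm.
lra.
Qed.

End Geometry.

(** Sets separated from the boundary are bounded for rho.  The bound comes
    from |B v - A u| <= a |v - u| + 2 |v| by completing a square. *)
Lemma sinh2_le_ball A B a b : 0 <= a < 1 -> 0 <= b < 1 -> opnorm A <= a -> opnorm B <= b ->
  sinh2_le (4 / ((1 - a ^+ 2) * (1 - b ^+ 2))) B A.
Proof.
move=> /andP[a0 a1] /andP[b0 b1] Aa Bb v u.
have a2 : 0 < 1 - a ^+ 2 by rewrite subr_gt0 exprn_ilt1.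
have b2 : 0 < 1 - b ^+ 2 by rewrite subr_gt0 exprn_ilt1.
set mu := _ / _.
have Bv : nrm (B v) <= b * nrm v.
  by apply: le_trans (opnorm_bound _ _) _; rewrite ler_wpM2r ?nrm_ge0.
have Au : nrm (A (v - u)) <= a * nrm (v - u).
  by apply: le_trans (opnorm_bound _ _) _; rewrite ler_wpM2r ?nrm_ge0.
have Av : nrm (A v) <= nrm v.
  apply: le_trans (opnorm_bound _ _) _; rewrite ler_piMl ?nrm_ge0//.
  by apply: ltW; apply: le_lt_trans a1.
have Bv1 : nrm (B v) <= nrm v.
  by apply: le_trans Bv _; rewrite ler_piMl ?nrm_ge0// ltW.
have tri : nrm (B v - A u) <= a * nrm (v - u) + 2 * nrm v.
  have -> : B v - A u = A (v - u) + (B v - A v) by rewrite opB [RHS]addrC addrA subrK.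
  have := nrmD (A (v - u)) (B v - A v); have := nrmD (B v) (- A v); rewrite nrmN; lra.
have mu_v : 4 / (1 - a ^+ 2) * nrm v ^+ 2 <= mu * (nrm v ^+ 2 - nrm (B v) ^+ 2).
  have -> : mu = 4 / (1 - a ^+ 2) / (1 - b ^+ 2) by rewrite /mu invfM mulrA.
  have k0 : 0 <= 4 / (1 - a ^+ 2) by rewrite divr_ge0 // ltW.
  rewrite -[leRHS]mulrA ler_wpM2l// [leRHS]mulrC ler_pdivlMr//.
  have : nrm (B v) ^+ 2 <= (b * nrm v) ^+ 2 by rewrite lerXn2r ?nnegrE ?mulr_ge0 ?nrm_ge0.
  by rewrite exprMn; lra.
have sq : nrm (B v - A u) ^+ 2 <= (a * nrm (v - u) + 2 * nrm v) ^+ 2.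
  by rewrite lerXn2r ?nnegrE ?addr_ge0 ?mulr_ge0 ?nrm_ge0.
have fin : (a * nrm (v - u) + 2 * nrm v) ^+ 2 <= nrm (v - u) ^+ 2 + 4 / (1 - a ^+ 2) * nrm v ^+ 2.
  rewrite -subr_ge0.
  have -> : nrm (v - u) ^+ 2 + 4 / (1 - a ^+ 2) * nrm v ^+ 2 - (a * nrm (v - u) + 2 * nrm v) ^+ 2
     = ((1 - a ^+ 2) * nrm (v - u) - 2 * a * nrm v) ^+ 2 / (1 - a ^+ 2).
    by field; rewrite gt_eqF.
  by rewrite divr_ge0 ?sqr_ge0 ?ltW.
lra.
Qed.

(** With t = tanh r the left-hand side is sinh(r)^2. *)
Lemma tanh_sq_exists (mu : R) : 0 <= mu ->
  exists2 t, 0 <= t < 1 & t ^+ 2 / (1 - t ^+ 2) = mu.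
Proof.
move=> mu0; have m1 : 0 < 1 + mu by rewrite ltr_pwDl.
have q0 : 0 <= mu / (1 + mu) by rewrite divr_ge0 // ltW.
exists (Num.sqrt (mu / (1 + mu))).
  rewrite sqrtr_ge0 /= -[ltRHS]sqrtr1 ltr_sqrt// ltr_pdivrMr// mul1r; lra.
rewrite sqr_sqrtr//; have -> : 1 - mu / (1 + mu) = (1 + mu)^-1 by field; rewrite gt_eqF.
by rewrite invrK divfK ?gt_eqF.
Qed.

(** This bound makes artanh injective on the values that define rho. *)
Lemma opnorm_mobius_lt1 A B : opnorm A < 1 -> opnorm B < 1 -> opnorm (mobius A B) < 1.
Proof.
move=> A1 B1.
have a1 : 0 <= opnorm A < 1 by rewrite opnorm_ge0.
have b1 : 0 <= opnorm B < 1 by rewrite opnorm_ge0.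
have W : sinh2_le (4 / ((1 - opnorm A ^+ 2) * (1 - opnorm B ^+ 2))) B (- A).
  by apply: sinh2_le_ball => //; rewrite opnormN.
have [|t t01 tE] := tanh_sq_exists (_ : 0 <= 4 / ((1 - opnorm A ^+ 2) * (1 - opnorm B ^+ 2))).
  by rewrite divr_ge0 ?mulr_ge0 // subr_ge0 exprn_ile1 ?opnorm_ge0 // ltW.
have /andP[_] := t01; apply: le_lt_trans.
by apply/(mobius_le A1 B1 t01); rewrite tE.
Qed.

(** Rho-isometries preserve each relation [sinh2_le mu], because rho determines
    the norm from which it is computed. *)
Lemma rho_sinh2_le (A B A' B' : opBall K H) mu : 0 <= mu -> rho A' B' = rho A B ->
  sinh2_le mu B A -> sinh2_le mu B' A'.
Proof.
move=> mu0; rewrite /rho => e.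
have b1 (X : opBall K H) : opnorm X < 1 by case: X.
have n1 (X Y : opBall K H) : -1 < opnorm (mobius (- (X : boundedOp K H)) Y) < 1.
  rewrite opnorm_mobius_lt1 ?opnormN// andbT.
  by apply: lt_le_trans (opnorm_ge0 _); rewrite ltrN10.
have {}e : opnorm (mobius (- (A' : boundedOp K H)) B') = opnorm (mobius (- (A : boundedOp K H)) B).
  by rewrite -(artanhK (n1 A' B')) e artanhK.
have [t t01 <-] := tanh_sq_exists mu0.
have key (X Y : opBall K H) : opnorm (mobius (- (X : boundedOp K H)) Y) <= t <->
    sinh2_le (t ^+ 2 / (1 - t ^+ 2)) Y X.
  by rewrite -{2}[X : boundedOp K H]opprK; apply: mobius_le => //; rewrite opnormN.
by move=> /key; rewrite -e => /key.
Qed.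

End Mobius.

(** * Midpoints and finite nets *)

Section Vectors.
Variables (R : realType) (s : scalar_kind) (V : hilbertType R s).
Implicit Types x y : V.

Definition midv x y : V := scal s 2^-1 *: (x + y).

Lemma nrm_midv x y :
  nrm (midv x y) ^+ 2 = 2^-1 * nrm x ^+ 2 + 2^-1 * nrm y ^+ 2 - 4^-1 * nrm (x - y) ^+ 2.
Proof. by rewrite /midv nrmZr exprMn real_normK ?num_real// nrmB_sq nrmD_sq; field. Qed.

Lemma midvB x y z : midv x y - z = midv (x - z) (y - z).
Proof.
have e : scal s 2^-1 *: (z + z) = z.
  rewrite scalerDr -scalerDl -scalD (_ : 2^-1 + 2^-1 = 1 :> R); last by lra.
  by rewrite scal1 scale1r.
by rewrite /midv addrACA -opprD scalerBr e.
Qed.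

Lemma unit_ball_net (f : seq V) : parseval_frame f -> forall d, 0 < d ->
  exists L : seq V, forall x, nrm x <= 1 -> exists2 l, l \in L & nrm (x - l) <= d.
Proof.
move=> fV; suff H d : 0 < d -> exists L : seq V,
    forall x, nrm x <= 1 -> exists2 l, l \in L & nrm (proj_frame f x - l) <= d.
  by move=> d /H[L HL]; exists L => x /HL; rewrite fV.
elim: f {fV} d => [|w f IH] d d0.
  exists [:: 0] => x _; exists 0; first by rewrite inE.
  by rewrite /proj_frame big_nil subr0 nrm0 ltW.
have d2 : 0 < d / 2 by rewrite divr_gt0.
have [L HL] := IH _ d2.
have w1 : 0 < nrm w + 1 by rewrite ltr_wpDl ?nrm_ge0.
have [S HS] := scalar_net s (nrm w) (divr_gt0 d2 w1).
exists [seq c *: w + l | c <- S, l <- L] => x x1.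
have [l lL hl] := HL x x1.
have [|c cS hc] := HS (inner x w).
  apply: le_trans (norm_inner_le _ _) _.
  by rewrite ler_piMl ?nrm_ge0.
exists (c *: w + l); first by apply/allpairsP; exists (c, l).
rewrite /proj_frame big_cons -/(proj_frame f x) opprD addrACA -scalerBl.
apply: le_trans (nrmD _ _) _; rewrite nrmZ.
have : scalar_Re `|inner x w - c| * nrm w <= d / 2.
  move: hc; rewrite ler_pdivlMr// => hc.
  apply: le_trans hc; rewrite ler_wpM2l ?lerDl//.
  by rewrite -(@scal_ge0 R s) -ge0_scal.
lra.
Qed.

End Vectors.

(** * Convexity and closedness of rho-balls *)

Section Convexity.
Variables (R : realType) (s : scalar_kind) (K H : hilbertType R s).
Implicit Types X Y Z B : boundedOp K H.

Definition gap (mu : R) X B v u :=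
  mu * (nrm v ^+ 2 - nrm (X v) ^+ 2) + nrm (v - u) ^+ 2 - nrm (X v - B u) ^+ 2.

Lemma sinh2_le_gap mu X B : sinh2_le mu X B <-> forall v u, 0 <= gap mu X B v u.
Proof. by split=> h v u; have := h v u; rewrite /gap; lra. Qed.

Definition is_mid X Y Z := forall v, Z v = midv (X v) (Y v).

(** The extra term is the defect of the parallelogram law in the two negative
    squares: mu/4 from |X v|^2 and 1/4 from |X v - B u|^2. *)
Lemma gap_mid mu X Y Z B v u : is_mid X Y Z ->
  gap mu Z B v u = 2^-1 * gap mu X B v u + 2^-1 * gap mu Y B v u
    + (1 + mu) / 4 * nrm (X v - Y v) ^+ 2.
Proof.
move=> XYZ; rewrite /gap XYZ midvB !nrm_midv.
have -> : X v - B u - (Y v - B u) = X v - Y v by rewrite opprB addrA subrK.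
by field.
Qed.

Lemma sinh2_le_mid mu X Y Z B : 0 <= mu -> is_mid X Y Z ->
  sinh2_le mu X B -> sinh2_le mu Y B -> sinh2_le mu Z B.
Proof.
move=> mu0 XYZ /sinh2_le_gap hX /sinh2_le_gap hY; apply/sinh2_le_gap => v u.
rewrite (gap_mid _ _ _ _ XYZ).
have h : 0 <= (1 + mu) / 4 * nrm (X v - Y v) ^+ 2.
  by rewrite mulr_ge0 ?sqr_ge0// divr_ge0// addr_ge0.
by have := hX v u; have := hY v u; lra.
Qed.

Lemma sinh2_le_closed mu B : 0 <= mu -> op_closed (fun X => sinh2_le mu X B).
Proof.
move=> mu0 X HX v u; rewrite -subr_le0.
set n := nrm v; have n0 : 0 <= n := nrm_ge0 v.
set P := nrm (X v - B u) + n; set Q := nrm (X v) + n.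
have P0 : 0 <= P by rewrite addr_ge0 ?nrm_ge0.
have Q0 : 0 <= Q by rewrite addr_ge0 ?nrm_ge0.
apply: (@le0_small _ _ (2 * P * n + n ^+ 2 + mu * (2 * Q * n + n ^+ 2))).
  by do ![exact: P0 | exact: Q0 | done | exact: sqr_ge0 | apply: addr_ge0 | apply: mulr_ge0].
move=> d d0; have m0 : 0 < Num.min d 1 by rewrite lt_min d0 ltr01.
have [Z Zw ZX] := HX _ m0.
have ZXd : nrm (Z v - X v) <= d * n.
  by apply: le_trans (ZX v) _; rewrite ler_wpM2r// ge_min lexx.
have ZX1 : nrm (Z v - X v) <= n.
  by apply: le_trans (ZX v) _; rewrite ler_piMl// ge_min lexx orbT.
have bnd (x z : H) : nrm (z - x) <= d * n -> nrm (z - x) <= n ->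
    nrm x ^+ 2 <= nrm z ^+ 2 + d * (2 * (nrm x + n) * n + n ^+ 2).
  move=> h1 h2; have h3 := nrmD (x - z) z; rewrite subrK nrm_distC in h3.
  have h4 := nrmD (z - x) x; rewrite subrK in h4.
  have x0 := nrm_ge0 x; have z0 := nrm_ge0 z; have e0 := nrm_ge0 (z - x).
  set e := nrm (z - x) in h1 h2 h3 h4 e0.
  have h5 : nrm x ^+ 2 <= (nrm z + e) ^+ 2 by rewrite lerXn2r ?nnegrE ?addr_ge0// addrC.
  have h6 : e * nrm z <= d * n * (nrm x + n).
    apply: ler_pM => //; lra.
  have h7 : e ^+ 2 <= d * n * n by rewrite expr2; apply: ler_pM => //; lra.
  by rewrite !expr2 in h5 h7 *; lra.
have b1 := bnd (X v - B u) (Z v - B u).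
rewrite opprB addrA subrK in b1; have {}b1 := b1 ZXd ZX1.
have b2 := ler_wpM2l mu0 (bnd (X v) (Z v) ZXd ZX1).
have := Zw v u; rewrite -/P -/Q -/n in b1 b2 *; lra.
Qed.

(** A point at bounded distance from a point of the ball of radius a is
    uniformly inside the unit ball: take u = (1 - a) v in the inequalities. *)
Lemma sinh2_le_inside mu a X B : 0 <= a < 1 -> 0 <= mu -> opnorm X <= 1 -> opnorm B <= a -> sinh2_le mu X B ->
  opnorm X <= Num.sqrt (1 - (1 - a) ^+ 2 / (1 + mu)).
Proof.
move=> /andP[a0 a1] mu0 X1 Ba XB.
have m1 : 0 < 1 + mu by rewrite ltr_pwDl.
have q0 : 0 <= 1 - (1 - a) ^+ 2 / (1 + mu).
  by rewrite subr_ge0 ler_pdivrMr// mul1r; nra.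
apply: opnorm_le => [|v]; first exact: sqrtr_ge0.
rewrite -[leLHS]ger0_norm ?nrm_ge0// -sqrtr_sqr.
rewrite -[nrm v]ger0_norm ?nrm_ge0// -sqrtr_sqr -sqrtrM// ler_wsqrtr//.
have := XB v (scal s (1 - a) *: v); rewrite opZ.
have -> : v - scal s (1 - a) *: v = scal s a *: v.
  by rewrite -{1}[v]scale1r -(scal1 R s) -scalerBl -scalB; congr (scal s _ *: _); lra.
rewrite nrmB_sq !nrmZr rinZr.
have hB : nrm (B v) <= a * nrm v.
  by apply: le_trans (opnorm_bound _ _) _; rewrite ler_wpM2r ?nrm_ge0.
have hX : nrm (X v) <= nrm v.
  by apply: le_trans (opnorm_bound _ _) _; rewrite ler_piMl ?nrm_ge0.
have hr : rin (X v) (B v) <= a * nrm v ^+ 2.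
  apply: le_trans (rin_le _ _) _; rewrite expr2 mulrCA.
  by apply: ler_pM; rewrite ?nrm_ge0.
rewrite !exprMn !real_normK ?num_real// => h.
have h1 : (1 - a) * rin (X v) (B v) <= (1 - a) * (a * nrm v ^+ 2) by rewrite ler_pM2l// subr_gt0.
have h2 : 0 <= (1 - a) ^+ 2 * nrm (B v) ^+ 2 by rewrite mulr_ge0 ?sqr_ge0.
have h3 : (1 + mu) * nrm (X v) ^+ 2 <= ((1 + mu) - (1 - a) ^+ 2) * nrm v ^+ 2 by lra.
rewrite -(ler_pM2l m1) [leRHS]mulrA; apply: le_trans h3 _.
suff -> : (1 + mu) * (1 - (1 - a) ^+ 2 / (1 + mu)) = 1 + mu - (1 - a) ^+ 2 by [].
by field; rewrite gt_eqF.
Qed.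

End Convexity.

(** * Convex closed subsets of the operator ball *)

Section Balls.
Variables (R : realType) (s : scalar_kind) (K H : hilbertType R s).
Hypothesis finK : finite_dimensional K.
Local Notation ball := (opBall K H).
Implicit Types (X Y Z B : ball) (C : set ball).

Lemma opBall_lt1 X : opnorm X < 1. Proof. by case: X. Qed.

Lemma opBall_ext X Y : X =1 Y -> X = Y.
Proof.
case: X Y => [X X1] [Y Y1] /= /op_ext XY; move: X1 Y1; rewrite XY => X1 Y1.
by congr OpBall; exact: bool_irrelevance.
Qed.

Lemma opBall_le1 X v : nrm (X v) <= nrm v.
Proof.
apply: le_trans (opnorm_bound _ _) _.
by rewrite ler_piMl ?nrm_ge0 ?ltW ?opBall_lt1.
Qed.

Lemma ball_diff_near X Y v l :
  nrm (X v - Y v) <= nrm (X l - Y l) + 2 * nrm (v - l).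
Proof.
have -> : X v - Y v = X (v - l) + (X l - Y l) - Y (v - l).
  by rewrite !opB opprB !addrA !subrK.
have := nrmD (X (v - l) + (X l - Y l)) (- Y (v - l)); rewrite nrmN.
have := nrmD (X (v - l)) (X l - Y l).
by have := opBall_le1 X (v - l); have := opBall_le1 Y (v - l); lra.
Qed.

Definition midpoint_convex C := forall X Y Z, C X -> C Y -> is_mid X Y Z -> C Z.

Definition norm_closed C := forall X,
  (forall d, 0 < d -> exists2 Z, C Z & forall v, nrm (Z v - X v) <= d * nrm v) -> C X.

Lemma is_mid_exists X Y : exists Z, is_mid X Y Z.
Proof.
have hl : opnorm (scal s 2^-1 *: ((X : boundedOp K H) + Y)) < 1.
  have m0 : 0 <= (opnorm X + opnorm Y) / 2 by rewrite divr_ge0// addr_ge0 ?opnorm_ge0.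
  have : opnorm (scal s 2^-1 *: ((X : boundedOp K H) + Y)) <= (opnorm X + opnorm Y) / 2.
    apply: opnorm_le => // v; rewrite scaleopE addopE nrmZr ger0_norm ?invr_ge0//.
    have := nrmD (X v) (Y v); have := opnorm_bound X v; have := opnorm_bound Y v; lra.
  by have := opBall_lt1 X; have := opBall_lt1 Y; lra.
by exists (OpBall hl) => v.
Qed.

Section Nested.
Variable f : seq K.
Hypothesis fK : parseval_frame f.

(** The square of the Hilbert-Schmidt norm when f is an orthonormal basis. *)
Definition hs (A : boundedOp K H) : R := \sum_(v <- f) nrm (A v) ^+ 2.

Lemma hs_ge0 (A : boundedOp K H) : 0 <= hs A.
Proof. by apply: sumr_ge0 => v _; exact: sqr_ge0. Qed.

Lemma hs_dominates (A : boundedOp K H) x : nrm (A x) <= (\sum_(v <- f) nrm v) * Num.sqrt (hs A) * nrm x.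
Proof.
rewrite -{1}(fK x) op_sum; apply: le_trans (nrm_sum _ _) _.
rewrite !mulr_suml !big_seq; apply: ler_sum => v vf.
rewrite opZ nrmZ mulrAC [leRHS]mulrC [leRHS]mulrC.
have hA : nrm (A v) <= Num.sqrt (hs A).
  rewrite -[leLHS]ger0_norm ?nrm_ge0// -sqrtr_sqr ler_wsqrtr//.
  rewrite /hs (perm_big _ (perm_to_rem vf)) big_cons lerDl.
  by apply: sumr_ge0 => ? _; exact: sqr_ge0.
apply: ler_pM; rewrite ?nrm_ge0 //.
  by rewrite -(@scal_ge0 R s) -ge0_scal.
by rewrite mulrC norm_inner_le.
Qed.

Lemma hs_mid (X Y Z : boundedOp K H) : is_mid X Y Z ->
  hs (X - Y) = 2 * hs X + 2 * hs Y - 4 * hs Z.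
Proof.
move=> XYZ; rewrite /hs !mulr_sumr -big_split/= -sumrB; apply: eq_bigr => v _.
by rewrite XYZ nrm_midv -[Z in nrm Z ^+ 2 = _]/(X v - Y v); field.
Qed.

(** Nearly minimal elements for the Hilbert-Schmidt norm converge.  Let M be
    the supremum over the chain of the infima of hs.  If the infimum over C
    exceeds M - e, the midpoint of two elements of C with hs at most M + e has
    hs above M - e, so the two elements are close.  A sequence chosen in this
    way is Cauchy, and each member D of the chain has elements close to its
    terms, which puts the limit into D. *)
Lemma nested_inter (T : set (set ball)) (a : R) :
  (exists C, T C) -> (forall C D, T C -> T D -> C `<=` D \/ D `<=` C) ->
  (forall C, T C -> [/\ exists X, C X, midpoint_convex C, norm_closed C
     & forall X, C X -> opnorm X <= a]) -> a < 1 ->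
  exists X, forall C, T C -> C X.
Proof.
move=> [C0 TC0] chainT TP a1.
pose val C := [set hs X | X in C].
pose m C := inf (val C).
have m_le C X : C X -> m C <= hs X.
  by move=> CX; apply: ge_inf; [exists 0 => _ [Y _ <-]; exact: hs_ge0 | exists X].
have hs_bd X : hs X <= \sum_(v <- f) nrm v ^+ 2.
  by apply: ler_sum => v _; rewrite lerXn2r ?nnegrE ?nrm_ge0 ?opBall_le1.
have hsup : has_sup [set m C | C in T].
  split; first by exists (m C0), C0.
  exists (\sum_(v <- f) nrm v ^+ 2) => _ [C TC <-].
  by have [[X CX] _ _ _] := TP _ TC; apply: le_trans (m_le _ _ CX) _.
set M := sup [set m C | C in T].
have near_min C e : T C -> 0 < e -> exists2 X, C X & hs X <= M + e.
  move=> TC e0; have [[X0 CX0] _ _ _] := TP _ TC.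
  have hi : has_inf (val C).
    by split; [exists (hs X0), X0 | exists 0 => _ [Y _ <-]; exact: hs_ge0].
  have [_ [X CX <-] hX] := inf_adherent e0 hi.
  exists X => //; apply: le_trans (ltW hX) _; rewrite lerD2r.
  by apply: sup_upper_bound => //; exists C.
have close C X Y e : T C -> M - e < m C -> C X -> C Y ->
    hs X <= M + e -> hs Y <= M + e -> hs ((X : boundedOp K H) - (Y : boundedOp K H)) <= 8 * e.
  move=> TC mC CX CY hX hY; have [_ midC _ _] := TP _ TC.
  have [Z XYZ] := is_mid_exists X Y.
  by rewrite (hs_mid XYZ); have := m_le _ _ (midC _ _ _ CX CY XYZ); lra.
pose ep (n : nat) : R := n.+1%:R^-1.
have ep0 n : 0 < ep n by rewrite invr_gt0.
have pick n : exists p : set ball * ball,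
    [/\ T p.1, M - ep n < m p.1, p.1 p.2 & hs p.2 <= M + ep n].
  have [_ [C TC <-] hC] := sup_adherent (ep0 n) hsup.
  by have [X CX hX] := near_min _ _ TC (ep0 n); exists (C, X).
have [p pP] := choice pick.
set k := \sum_(v <- f) nrm v.
have k0 : 0 <= k by apply: sumr_ge0 => v _; exact: nrm_ge0.
pose e n := k * Num.sqrt (8 * ep n).
have e_of (A : boundedOp K H) n x : hs A <= 8 * ep n -> nrm (A x) <= e n * nrm x.
  move=> hA; apply: le_trans (hs_dominates A x) _.
  by rewrite ler_wpM2r ?nrm_ge0// ler_wpM2l// ler_wsqrtr.
have ep_le n j : (n <= j)%N -> ep j <= ep n.
  by move=> nj; rewrite lef_pV2 ?posrE// ler_nat.
have e_small d : 0 < d -> exists n, e n < d.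
  move=> d0; pose q := (d / (k + 1)) ^+ 2 / 8.
  have k1 : 0 < k + 1 by rewrite ltr_wpDl.
  have dk : 0 < d / (k + 1) by rewrite divr_gt0.
  have q0 : 0 < q by rewrite divr_gt0// exprn_gt0.
  exists (Num.truncn q^-1); set n := Num.truncn _.
  have h : ep n < q.
    by rewrite /ep invf_plt ?posrE// truncnS_gt.
  have hs1 : Num.sqrt (8 * ep n) <= d / (k + 1).
    rewrite -[leRHS]gtr0_norm// -sqrtr_sqr ler_wsqrtr//.
    by move: h; rewrite /q ltr_pdivlMr// mulrC => /ltW.
  apply: (@le_lt_trans _ _ (k * (d / (k + 1)))); first by rewrite ler_wpM2l.
  by rewrite mulrCA gtr_pMr// ltr_pdivrMr// mul1r ltrDl.
have [S SP] : exists S : boundedOp K H, forall n x, nrm ((p n).2 x - S x) <= e n * nrm x.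
  apply: complete_op e_small => n j x nj.
  suff : hs (((p j).2 : boundedOp K H) - ((p n).2 : boundedOp K H)) <= 8 * ep n by move/e_of; apply.
  have [Tj mj Cj hj] := pP j; have [Tn mn Cn hn] := pP n; have enj := ep_le _ _ nj.
  have hj' : hs (p j).2 <= M + ep n by apply: le_trans hj _; rewrite lerD2l.
  have [sub|sub] := chainT _ _ Tn Tj.
    apply: le_trans (close _ _ _ _ Tj _ Cj (sub _ Cn) hj' hn) _ => //.
    by apply: le_lt_trans mj; rewrite lerB.
  by apply: (close _ _ _ _ Tn) => //; exact: sub.
have a0 : 0 <= a.
  by have [[X CX] _ _ /(_ _ CX)] := TP _ TC0; apply: le_trans; exact: opnorm_ge0.
have Sa : opnorm S <= a.
  apply: opnorm_le => //; apply: op_closed_bound => d /e_small[n nd].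
  exists (p n).2 => x; last first.
    by apply: le_trans (SP n x) _; rewrite ler_wpM2r ?nrm_ge0// ltW.
  have [Tn _ Cn _] := pP n; have [_ _ _ /(_ _ Cn) Xa] := TP _ Tn.
  by apply: le_trans (opnorm_bound _ _) _; rewrite ler_wpM2r ?nrm_ge0.
exists (OpBall (le_lt_trans Sa a1)) => D TD.
have [_ _ Dcl _] := TP _ TD; apply: Dcl => d d0 /=.
have [n nd] := e_small _ (divr_gt0 d0 (ltr0n R 2)).
have [Tn mn Cn hn] := pP n.
(* Of D and the n-th chosen set one contains the other: the smaller one has a
   nearly minimal element, which lies in both. *)
have [Y [DY CY hY]] : exists Y, [/\ D Y, (p n).1 Y & hs Y <= M + ep n].
  have [sub|sub] := chainT _ _ TD Tn.
    by have [Y DY hY] := near_min _ _ TD (ep0 n); exists Y; split=> //; exact: sub.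
  by have [Y CY hY] := near_min _ _ Tn (ep0 n); exists Y; split=> //; exact: sub.
exists Y => // v.
have h1 := e_of _ _ v (close _ _ _ _ Tn mn CY Cn hY hn).
have h2 := SP n v; have h3 := ler_wpM2r (nrm_ge0 v) (ltW nd).
have := nrmD (Y v - (p n).2 v) ((p n).2 v - S v); rewrite addrA subrK.
move: h1; rewrite addopE oppopE; lra.
Qed.

End Nested.

(** A convex set uniformly inside the ball contains a point whose distances to
    all points of the set are uniformly smaller than the diameter.  Every vector
    l of a finite net is either flat, meaning that all elements of C nearly
    agree at l, or it is made good by averaging X with the midpoint of two
    elements of C that differ at l; averaging keeps the vectors that were good
    before, with half the margin. *)
Lemma normal_structure C (a mu : R) : 0 <= a < 1 -> 0 < mu ->
  (exists X, C X) -> midpoint_convex C -> (forall X, C X -> opnorm X <= a) ->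
  (forall X B, C X -> C B -> sinh2_le mu X B) ->
  exists X nu, [/\ C X, 0 <= nu < mu & forall B, C B -> sinh2_le nu X B].
Proof.
move=> /andP[a0 a1] mu0 [X0 CX0] midC Ca diamC.
have [f fK] := finite_dimensional_frame finK.
have Cv X v : C X -> nrm (X v) <= a * nrm v.
  by move=> /Ca Xa; apply: le_trans (opnorm_bound _ _) _; rewrite ler_wpM2r ?nrm_ge0.
pose al := 1 - a ^+ 2; have al0 : 0 < al by rewrite subr_gt0 exprn_ilt1.
(* The tolerance e' is chosen so that at vectors v where X and B differ by at
   most e' the loss e'^2 / al eats at most half of the gain mu * al.
   Passing from a net vector l to a vector v within e' / 8 of it changes the
   difference of two elements of C by at most e' / 4, so the threshold e' / 2 at
   l leaves at least e' / 4 in the far case and at most e' in the flat case. *)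
pose e' := al * Num.min 1 mu / 2.
have m0 : 0 < Num.min 1 mu by rewrite lt_min ltr01.
have e'0 : 0 < e' by rewrite divr_gt0// mulr_gt0.
have e'2 : e' ^+ 2 / al <= mu * al / 2.
  have h1 : Num.min 1 mu <= 1 by rewrite ge_min lexx.
  have h2 : Num.min 1 mu <= mu by rewrite ge_min lexx orbT.
  rewrite ler_pdivrMr// /e'; set w := Num.min 1 mu in m0 h1 h2 *.
  have h3 : w * w <= mu * 1 by apply: ler_pM => //; exact: ltW.
  have h4 := ler_wpM2l (mulr_ge0 (ltW al0) (ltW al0)) h3.
  have h5 : 0 <= al * al * mu by rewrite !mulr_ge0 ?ltW.
  by rewrite expr2; lra.
have gap0 X B v u : C X -> C B -> 0 <= gap mu X B v u.
  by move=> CX CB; have /sinh2_le_gap := diamC _ _ CX CB; apply.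
pose good (X : ball) eta l := forall B, C B -> forall v u,
  nrm (v - l) <= e' / 8 -> eta <= gap mu X B v u.
pose flat l := forall Y Z, C Y -> C Z -> nrm (Y l - Z l) < e' / 2.
have avg (L : seq K) : exists X eta, [/\ C X, 0 < eta &
    forall l, l \in L -> flat l \/ good X eta l].
  elim: L => [|l L [X [eta [CX eta0 HX]]]]; first by exists X0, 1.
  have [fl|] := pselect (flat l).
    by exists X, eta; split=> // l'; rewrite inE => /predU1P[->|/HX//]; left.
  move=> nfl; have [Y [Z [CY CZ far]]] : exists Y Z, [/\ C Y, C Z & e' / 2 <= nrm (Y l - Z l)].
    apply: contrapT => h; apply: nfl => Y Z CY CZ; rewrite ltNge; apply/negP => far.
    by apply: h; exists Y, Z.
  have [W YZW] := is_mid_exists Y Z; have CW := midC _ _ _ CY CZ YZW.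
  have [X' XWX'] := is_mid_exists X W.
  have gX' B v u : gap mu X' B v u >= 2^-1 * gap mu X B v u + 2^-1 * gap mu W B v u.
    rewrite (gap_mid _ _ _ _ XWX') lerDl mulr_ge0 ?sqr_ge0// divr_ge0//.
    by rewrite addr_ge0// ltW.
  pose eta' := Num.min (eta / 2) (e' ^+ 2 / 128).
  have le1 : eta' <= eta / 2 by rewrite ge_min lexx.
  have le2 : eta' <= e' ^+ 2 / 128 by rewrite ge_min lexx orbT.
  exists X', eta'; split; first exact: (midC _ _ _ CX CW XWX').
    by rewrite lt_min !divr_gt0// exprn_gt0.
  move=> l'; rewrite inE => /predU1P[->{l'}|/HX[fl|gd]]; [right|by left|right].
    move=> B CB v u vl; apply: le_trans (gX' B v u).
    have gX := gap0 _ _ v u CX CB.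
    have gW : e' ^+ 2 / 64 <= gap mu W B v u.
      rewrite (gap_mid _ _ _ _ YZW).
      have far' : e' / 4 <= nrm (Y v - Z v).
        by have := ball_diff_near Y Z l v; rewrite (nrm_distC l v); lra.
      have h1 : (e' / 4) ^+ 2 <= nrm (Y v - Z v) ^+ 2.
        by rewrite lerXn2r ?nnegrE ?nrm_ge0// divr_ge0// ltW.
      have h2 : (1 / 4) * nrm (Y v - Z v) ^+ 2 <= (1 + mu) / 4 * nrm (Y v - Z v) ^+ 2.
        by rewrite ler_wpM2r ?sqr_ge0//; lra.
      have := gap0 _ _ v u CY CB; have := gap0 _ _ v u CZ CB.
      by rewrite exprMn in h1; lra.
    by lra.
  move=> B CB v u vl; apply: le_trans (gX' B v u).
  by have := gd B CB v u vl; have := gap0 _ _ v u CW CB; lra.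
have e80 : 0 < e' / 8 by rewrite divr_gt0.
have [L netL] := unit_ball_net fK e80.
have [X [eta [CX eta0 HX]]] := avg L.
pose eta1 := Num.min mu (Num.min eta (mu * al / 2)).
have eta1_le : [/\ eta1 <= mu, eta1 <= eta & eta1 <= mu * al / 2].
  by rewrite /eta1 !ge_min !lexx !orbT.
have eta10 : 0 < eta1 by rewrite !lt_min mu0 eta0 divr_gt0// mulr_gt0.
case: eta1_le => e1 e2 e3.
have unit_gap B v u : C B -> nrm v = 1 -> eta1 <= gap mu X B v u.
  move=> CB v1; have [|l lL vl] := netL v; first by rewrite v1.
  have [fl|gd] := HX _ lL; last by apply: le_trans e2 _; exact: gd.
  have near : nrm (X v - B v) <= e'.
    by have := ball_diff_near X B v l; have := fl _ _ CX CB; lra.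
  have XB : nrm (X v - B u) <= a * nrm (v - u) + e'.
    have -> : X v - B u = B (v - u) + (X v - B v) by rewrite opB [RHS]addrC addrA subrK.
    by have := nrmD (B (v - u)) (X v - B v); have := Cv _ (v - u) CB; lra.
  have sq : nrm (X v - B u) ^+ 2 <= (a * nrm (v - u) + e') ^+ 2.
    by rewrite lerXn2r ?nnegrE ?nrm_ge0 ?addr_ge0 ?mulr_ge0 ?nrm_ge0// ltW.
  have Xv : nrm (X v) ^+ 2 <= a ^+ 2.
    by rewrite lerXn2r ?nnegrE ?nrm_ge0//; have := Cv _ v CX; rewrite v1 mulr1.
  (* The minimum over x of x^2 - (a x + e')^2. *)
  have h : - (e' ^+ 2 / al) <= nrm (v - u) ^+ 2 - (a * nrm (v - u) + e') ^+ 2.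
    rewrite -subr_ge0.
    have -> : nrm (v - u) ^+ 2 - (a * nrm (v - u) + e') ^+ 2 - - (e' ^+ 2 / al) =
        (al * nrm (v - u) - a * e') ^+ 2 / al.
      by rewrite /al; field; rewrite gt_eqF.
    by rewrite divr_ge0 ?sqr_ge0 ?ltW.
  have h' : mu * al <= mu * (1 - nrm (X v) ^+ 2) by rewrite ler_pM2l// lerB.
  rewrite /gap v1 expr1n; lra.
have gap_hom B v u : C B -> eta1 * nrm v ^+ 2 <= gap mu X B v u.
  move=> CB; have [v0|nv] := eqVneq (nrm v) 0.
    by rewrite v0 expr0n /= mulr0; exact: gap0.
  have n0 : 0 < nrm v by rewrite lt0r nv nrm_ge0.
  pose c := scal s (nrm v)^-1.
  have hc (V : hilbertType R s) (x : V) : nrm (c *: x) = (nrm v)^-1 * nrm x.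
    by rewrite nrmZr ger0_norm// invr_ge0 nrm_ge0.
  have := unit_gap B (c *: v) (c *: u) CB; rewrite hc mulVf// => /(_ erefl).
  rewrite /gap !opZ -!scalerBr !hc !exprMn -!mulrBr => h.
  have n2 : 0 < nrm v ^+ 2 by rewrite exprn_gt0.
  have := ler_wpM2r (ltW n2) h; congr (_ <= _).
  by field.
exists X, (mu - eta1); split=> //; first by rewrite subr_ge0 e1 ltrBlDr ltrDl.
move=> B CB; apply/sinh2_le_gap => v u; have := gap_hom B v u CB; rewrite /gap.
have : 0 <= eta1 * nrm (X v) ^+ 2 by rewrite mulr_ge0 ?sqr_ge0 ?ltW.
lra.
Qed.

End Balls.

(** * The fixed point theorem *)

Theorem theorem3p10 (R : realType) (s : scalar_kind) (K H : hilbertType R s)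
    (finK : finite_dimensional K)
    (G : set (opBall K H -> opBall K H)) (isoG : rho_isometry_group G)
    (sepG : exists X : opBall K H, separated_from_boundary (map_orbit G X)) :
  exists X : opBall K H, forall g, G g -> g X = X.
Proof.
have [G1 GM GV Giso] := isoG.
have [X0 [r [r1 Xr]]] := sepG.
set E := map_orbit G X0 in Xr.
have EX0 : E X0 by exists idfun.
have r0 : 0 <= r by apply: le_trans (Xr _ EX0); exact: opnorm_ge0.
have r01 : 0 <= r < 1 by rewrite r0.
have r2 : 0 < 1 - r ^+ 2 by rewrite subr_gt0 exprn_ilt1.
pose mu0 := 4 / ((1 - r ^+ 2) * (1 - r ^+ 2)).
have mu00 : 0 <= mu0 by rewrite divr_ge0// mulr_ge0 ?ltW.
pose C0 : set (opBall K H) := [set X | forall e, E e -> sinh2_le mu0 X e].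
have EC0 : E `<=` C0.
  by move=> e /Xr er e' /Xr e'r; exact: sinh2_le_ball.
pose a := Num.sqrt (1 - (1 - r) ^+ 2 / (1 + mu0)).
have C0a X : C0 X -> opnorm X <= a.
  move=> /(_ _ EX0); apply: sinh2_le_inside => //; last exact: Xr.
  exact: ltW (opBall_lt1 X).
have a01 : 0 <= a < 1.
  rewrite sqrtr_ge0 /= -[ltRHS]sqrtr1 ltr_sqrt// gtrBl divr_gt0//.
    by rewrite exprn_gt0// subr_gt0.
  by rewrite ltr_pwDl.
pose invariant (C : set (opBall K H)) := forall g X, G g -> C X -> C (g X).
pose ok (C : set (opBall K H)) := [/\ exists X, C X, midpoint_convex C, norm_closed C, invariant C & C `<=` C0].
(* The point B is itself an image g (h B) of an element of C, so the relation
   between X and h B can be transported by g. *)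
have ginv nu g (X : opBall K H) (C : set (opBall K H)) : 0 <= nu -> G g -> invariant C ->
    (forall B, C B -> sinh2_le nu X B) -> forall B, C B -> sinh2_le nu (g X) B.
  move=> nu0 Gg iC XC B CB; have [h [Gh gh hg]] := GV _ Gg.
  rewrite -(hg B); apply: (rho_sinh2_le finK nu0 (Giso _ Gg (h B) X)).
  by apply: XC; exact: iC.
have ballmid nu (B X Y Z : opBall K H) : 0 <= nu -> is_mid X Y Z ->
    sinh2_le nu X B -> sinh2_le nu Y B -> sinh2_le nu Z B.
  exact: sinh2_le_mid.
have ballclosed nu (B X : opBall K H) : 0 <= nu -> (forall d, 0 < d ->
   exists2 Z : opBall K H, sinh2_le nu Z B & forall v, nrm (Z v - X v) <= d * nrm v) -> sinh2_le nu X B.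
  by move=> nu0 HX; apply: (sinh2_le_closed nu0) => d /HX[Z]; exists Z.
have Einv : invariant E.
  by move=> g _ Gg [h Gh <-]; exists (g \o h) => //; exact: GM.
have okC0 : ok C0.
  split=> //; first by exists X0; exact: EC0.
  - by move=> X Y Z CX CY XYZ e Ee; apply: (ballmid _ _ _ _ _ mu00 XYZ); [exact: CX|exact: CY].
  - move=> X HX e Ee; apply: ballclosed mu00 _ => d /HX[Z CZ ZX].
    by exists Z => //; exact: CZ.
  - by move=> g X Gg CX; exact: ginv.
have [[C okC] minC] : exists C : {C | ok C}, forall D : {D | ok D},
    `[< sval D `<=` sval C >] -> D = C.
  apply: (@Zorn _ (fun C D : {C | ok C} => `[< sval D `<=` sval C >])).
  - by move=> C; apply/asboolP.
  - by move=> C D D' /asboolP CD /asboolP DD'; apply/asboolP; apply: subset_trans CD.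
  - move=> [C okC] [D okD] /asboolP /= CD /asboolP /= DC.
    have e : C = D by apply/seteqP.
    by subst D; congr exist; exact: Prop_irrelevance.
  - move=> A totA; have [[C1 A1]|nA] := pselect (exists C, A C); last first.
      by exists (exist _ _ okC0) => C AC; case: nA; exists C.
    pose T := [set sval C | C in A].
    have okT C : T C -> ok C by move=> [[D okD] _ <-].
    have [f fK] := finite_dimensional_frame finK.
    have [||||X HX] := @nested_inter _ _ _ _ f fK T a.
    - by exists (sval C1), C1.
    - move=> _ _ [C AC <-] [D AD <-].
      by have [/asboolP|/asboolP] := totA _ _ AC AD; [right|left].
    - by move=> C /okT[? ? ? _ CC0]; split=> // X /CC0; exact: C0a.
    - by case/andP: a01.
    have okI : ok (\bigcap_(C in T) C).
      split.
      - by exists X => C TC; exact: HX.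
      - move=> X1 X2 Z h1 h2 XZ C TC; have [_ mC _ _ _] := okT _ TC.
        by apply: (mC _ _ _ _ _ XZ); [exact: h1|exact: h2].
      - move=> X1 h1 C TC; have [_ _ cC _ _] := okT _ TC.
        by apply: cC => d /h1[Z hZ ZX]; exists Z => //; exact: hZ.
      - move=> g X1 Gg h1 C TC; have [_ _ _ iC _] := okT _ TC.
        by apply: iC => //; exact: h1.
      - move=> X1 h1; have TC1 : T (sval C1) by exists C1.
        by have [_ _ _ _] := okT _ TC1; apply; exact: h1.
    exists (exist _ _ okI) => C AC; apply/asboolP => X1 /= h1.
    by apply: h1; exists C.
have {}minC D : ok D -> D `<=` C -> D = C.
  by move=> okD DC; have /(congr1 sval) := minC (exist _ _ okD) (asboolT DC).
have [[XC CXC] midC clC invC CC0] := okC.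
pose diam := [set mu | 0 <= mu /\ forall X B, C X -> C B -> sinh2_le mu X B].
have diam_inf : has_inf diam.
  split; last by exists 0 => mu [].
  have /andP[a0 a1] := a01.
  have a2 : 0 < 1 - a ^+ 2 by rewrite subr_gt0 exprn_ilt1.
  exists (4 / ((1 - a ^+ 2) * (1 - a ^+ 2))); split.
    by rewrite divr_ge0// mulr_ge0 ?ltW.
  by move=> X B /CC0/C0a Xa /CC0/C0a Ba; exact: sinh2_le_ball.
have mu_ge0 : 0 <= inf diam by apply: lb_le_inf; [case: diam_inf|move=> mu []].
have mu_diam X B : C X -> C B -> sinh2_le (inf diam) X B.
  move=> CX CB v u; rewrite -subr_le0.
  have P0 : 0 <= nrm v ^+ 2 - nrm (X v) ^+ 2.
    by rewrite subr_ge0 lerXn2r ?nnegrE ?nrm_ge0// opBall_le1.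
  apply: (le0_small P0) => d d0; have [mu [mu0' muP] mud] := inf_adherent d0 diam_inf.
  have := muP _ _ CX CB v u; have := ler_wpM2r P0 (ltW mud); lra.
have [mu_pos|] := ltP 0 (inf diam).
  have [X [nu [CX /andP[nu0 nu_lt] Xnu]]] :=
    normal_structure finK a01 mu_pos (ex_intro _ _ CXC) midC (fun X CX => C0a X (CC0 X CX)) mu_diam.
  pose D := [set X | C X /\ forall B, C B -> sinh2_le nu X B].
  have okD : ok D.
    split.
    - by exists X.
    - move=> X1 X2 Z [C1 h1] [C2 h2] XZ; split; first exact: midC XZ.
      by move=> B CB; apply: (ballmid _ _ _ _ _ nu0 XZ); [exact: h1|exact: h2].
    - move=> X1 h1; split; first by apply: clC => d /h1[Z [CZ _] ?]; exists Z.
      move=> B CB; apply: ballclosed nu0 _ => d /h1[Z [_ ZB] ?].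
      by exists Z => //; exact: ZB.
    - by move=> g X1 Gg [CX1 h1]; split; [exact: invC|exact: ginv].
    - by move=> X1 [/CC0].
  have DC : D = C by apply: minC => // X1 [].
  have : inf diam <= nu.
    apply: ge_inf; first by case: diam_inf.
    by split=> // X1 B; rewrite -{1}DC => -[_ h] CB; exact: h.
  by rewrite leNgt nu_lt.
move=> mu_le0; have mu0' : inf diam = 0 by apply/le_anti; rewrite mu_le0.
(* With mu = 0 and u = v the inequality says that XC and its image agree at v. *)
exists XC => g Gg; apply: opBall_ext => v.
have := mu_diam _ _ (invC _ _ Gg CXC) CXC v v.
rewrite mu0' !mul0r !addr0 subrr nrm0 expr0n /= => h.
apply/eqP; rewrite -subr_eq0; apply/eqP/nrm0_eq0/eqP.
by rewrite -sqrf_eq0; apply/eqP/le_anti; rewrite h sqr_ge0.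
Qed.
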